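(* Let $(M,\Omega)$ be a holomorphic symplectic manifold of complex dimension $2n$ and let $N\subset M$ be an analytic real-symplectic form with symplectic form $\widehat\omega_R$. Suppose $u_1,\dots,u_n$ is an integrable system of (real) analytic functions on $(N,\widehat\omega_R)$. Then the holomorphic extensions of these functions defined in a neighbourhood of $N$ in $M$ form a holomorphic integrable system.
   Context: $\Omega=\omega_R+i\omega_I$ is a closed non-degenerate holomorphic 2-form on the complex manifold $M$. A real-symplectic form is a submanifold $N\subset M$ that is totally real ($T_xN\cap I(T_xN)=\{0\}$ for all $x\in N$), of half the real dimension of $M$, with $\Omega|_N$ purely real; then $\widehat\omega_R=\omega_R|_N$ is symplectic on $N$. It is analytic if it is a real-analytic submanifold. A (real) integrable system on $(N,\widehat\omega_R)$, $\dim_{\mathbb{R}}N=2n$, is a collection of $n$ functions that Poisson commute and whose derivatives are linearly independent on an open dense subset. A holomorphic integrable system on a holomorphic symplectic manifold of complex dimension $2n$ is a collection of $n$ holomorphic functions that Poisson commute for the complex Poisson bracket and whose derivatives are linearly independent on an open dense subset. The holomorphic extensions of $u_1,\dots,u_n$ are the holomorphic functions extending them to a sufficiently small open neighbourhood of $N$ (all of whose connected components meet $N$). *)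

(* Defs.v *)
From HB Require Import structures.
From mathcomp Require Import all_boot all_order all_algebra.
From mathcomp Require Import all_classical all_reals all_analysis.
From mathcomp Require Import complex.

Set Implicit Arguments.
Unset Strict Implicit.
Unset Printing Implicit Defensive.

Import Order.TTheory GRing.Theory Num.Theory.
Import numFieldNormedType.Exports.

Local Open Scope classical_set_scope.
Local Open Scope ring_scope.
Local Open Scope complex_scope.

(* Row-vector conventions.  A tangent vector in a chart is a row v; a bilinear
   form is the matrix W of its values on the coordinate vectors, so that
   W(v, w) = v W w^T; a differential is the row of its partial derivatives;
   the Jacobian acts by v |-> v *m jacobian f z, as in the library. *)

Section LocalCalculus.
Variables (K : numFieldType) (m : nat).

Definition grad (f : 'rV[K]_m -> K) (z : 'rV[K]_m) : 'rV[K]_m :=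
  \row_j 'D_(delta_mx 0 j) f z.

(* The X with W(X, .) = a, for W invertible. *)
Definition hamiltonian (W : 'M[K]_m) (a : 'rV[K]_m) : 'rV[K]_m :=
  a *m invmx W.

(* {f, g} = W(X_f, X_g), where a = df and b = dg at the given point. *)
Definition poisson (W : 'M[K]_m) (a b : 'rV[K]_m) : K :=
  (hamiltonian W a *m W *m (hamiltonian W b)^T) 0 0.

Definition independent_differentials n (f : 'I_n -> 'rV[K]_m -> K)
    (z : 'rV[K]_m) : bool :=
  row_free (\matrix_(i < n) grad (f i) z).

End LocalCalculus.

Section PowerSeries.
Variables (R : realType) (m : nat).

(* Sum of the terms whose exponents are all smaller than N. *)
Definition box_sum (c : {ffun 'I_m -> nat} -> R) (x : 'rV[R]_m) (N : nat) : R :=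
  \sum_(a : {ffun 'I_m -> 'I_N})
    c [ffun i => nat_of_ord (a i)] * \prod_i x 0 i ^+ a i.

(* f is, near x, the sum of an absolutely convergent power series in m
   variables. *)
Definition real_analytic_at (f : 'rV[R]_m -> R) (x : 'rV[R]_m) : Prop :=
  exists (c : {ffun 'I_m -> nat} -> R) (r : R), 0 < r /\
    forall y, ball x r y ->
      cvgn (box_sum (fun a => `|c a|) (map_mx Num.norm (y - x))) /\
      box_sum c (y - x) @ \oo --> f y.

End PowerSeries.

(* A K^m-valued chart of the subset S of T, for the subspace topology. *)
Record chart (K : numFieldType) (m : nat) (T : topologicalType) (S : set T) :=
  Chart {
    cdom : set T;
    ccod : set 'rV[K]_m;
    cfun : T -> 'rV[K]_m;
    cinv : 'rV[K]_m -> T;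
    cdom_open : exists2 V, open V & cdom = S `&` V;
    ccod_open : open ccod;
    cfun_cod : set_fun cdom ccod cfun;
    cinv_dom : set_fun ccod cdom cinv;
    cfunK : {in cdom, cancel cfun cinv};
    cinvK : {in ccod, cancel cinv cfun};
    cfun_continuous : {within cdom, continuous cfun};
    cinv_continuous : {within ccod, continuous cinv} }.

Record complex_manifold (R : realType) (m : nat) := ComplexManifold {
  carrier :> topologicalType;
  carrier_hausdorff : hausdorff_space carrier;
  carrier_second_countable : @second_countable carrier;
  atlas : set (chart R[i] m [set: carrier]);
  atlas_cover : forall x : carrier, exists2 phi, atlas phi & cdom phi x;
  atlas_holomorphic : forall phi psi, atlas phi -> atlas psi ->
    forall z, ccod phi z -> cdom psi (cinv phi z) ->
    differentiable (cfun psi \o cinv phi) z }.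

(* A closed non-degenerate holomorphic 2-form, given by its matrices of
   coefficients in the charts of the atlas. *)
Record holomorphic_symplectic_form (R : realType) (m : nat)
    (M : complex_manifold R m) := HolomorphicSymplecticForm {
  form_mx :> chart R[i] m [set: M] -> 'rV[R[i]]_m -> 'M[R[i]]_m;
  form_holomorphic : forall phi, atlas phi -> forall z, ccod phi z ->
    forall j k, differentiable (fun w => form_mx phi w j k : R[i]^o) z;
  form_alternating : forall phi, atlas phi -> forall z, ccod phi z ->
    (form_mx phi z)^T = - form_mx phi z;
  form_compatible : forall phi psi, atlas phi -> atlas psi ->
    forall z, ccod phi z -> cdom psi (cinv phi z) ->
    let J := jacobian (cfun psi \o cinv phi) z in
    form_mx phi z = J *m form_mx psi (cfun psi (cinv phi z)) *m J^T;
  form_closed : forall phi, atlas phi -> forall z, ccod phi z ->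
    forall i j k,
    let d i j k :=
      'D_(delta_mx 0 i) (fun w => form_mx phi w j k : R[i]^o) z in
    d i j k + d j k i + d k i j = 0;
  form_nondegenerate : forall phi, atlas phi -> forall z, ccod phi z ->
    form_mx phi z \in unitmx }.

Section RealSubmanifold.
Variables (R : realType) (m : nat) (M : complex_manifold R m) (N : set M).

(* A chart g of the subset N, seen in a chart phi of M. *)
Definition local_embedding (g : chart R m N) (phi : chart R[i] m [set: M])
    (t : 'rV[R]_m) : 'rV[R[i]]_m :=
  cfun phi (cinv g t).

(* Row j is the real partial derivative, along the j-th coordinate of g, of the
   C^m-valued map above. *)
Definition tangent_frame (g : chart R m N) (phi : chart R[i] m [set: M])
    (t : 'rV[R]_m) : 'M[R[i]]_m :=
  let F := local_embedding g phi in
  map_mx (real_complex R) (jacobian (fun s => map_mx (@complex.Re R) (F s)) t)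
  + 'i *: map_mx (real_complex R)
      (jacobian (fun s => map_mx (@complex.Im R) (F s)) t).

(* T_x N as a real subspace of T_x M = C^m, in the coordinates phi. *)
Definition tangent_space (g : chart R m N) (phi : chart R[i] m [set: M])
    (t : 'rV[R]_m) : set 'rV[R[i]]_m :=
  [set map_mx (real_complex R) a *m tangent_frame g phi t
     | a in [set: 'rV[R]_m]].

(* The inverse of g is a real-analytic immersion into M; with the topological
   conditions in chart, g is a chart of N as an embedded real-analytic
   submanifold of M of real dimension m, half that of M. *)
Definition analytic_chart (g : chart R m N) : Prop :=
  forall phi, atlas phi -> forall t, ccod g t -> cdom phi (cinv g t) ->
  (forall k, real_analytic_at
     (fun s => complex.Re (local_embedding g phi s 0 k)) t /\
   real_analytic_at
     (fun s => complex.Im (local_embedding g phi s 0 k)) t) /\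
  injective (fun a : 'rV[R]_m =>
    map_mx (real_complex R) a *m tangent_frame g phi t).

Definition analytic_submanifold : Prop :=
  forall x, N x -> exists2 g, analytic_chart g & cdom g x.

Definition totally_real : Prop :=
  forall g phi, analytic_chart g -> atlas phi ->
  forall t, ccod g t -> cdom phi (cinv g t) ->
  let TN := tangent_space g phi t in
  TN `&` [set 'i *: v | v in TN] = [set 0].

Definition restricts_to_real (Omega : holomorphic_symplectic_form M) : Prop :=
  forall g phi, analytic_chart g -> atlas phi ->
  forall t, ccod g t -> cdom phi (cinv g t) ->
  forall v w, tangent_space g phi t v -> tangent_space g phi t w ->
  complex.Im ((v *m Omega phi (local_embedding g phi t) *m w^T) 0 0) = 0.

Record analytic_real_symplectic_form (Omega : holomorphic_symplectic_form M) :
    Prop := AnalyticRealSymplecticForm {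
  rsf_submanifold : analytic_submanifold;
  rsf_totally_real : totally_real;
  rsf_real : restricts_to_real Omega }.

(* The restriction of omega_R = Re Omega to N, in the chart g; the chart phi of
   M only serves to compute it. *)
Definition induced_form (Omega : holomorphic_symplectic_form M)
    (g : chart R m N) (phi : chart R[i] m [set: M]) (t : 'rV[R]_m) : 'M[R]_m :=
  let A := tangent_frame g phi t in
  map_mx (@complex.Re R) (A *m Omega phi (local_embedding g phi t) *m A^T).

(* A function on N is represented by a function on M whose values outside N are
   irrelevant. *)
Definition analytic_on_submanifold (u : M -> R) : Prop :=
  forall g, analytic_chart g -> forall t, ccod g t ->
  real_analytic_at (u \o cinv g) t.

End RealSubmanifold.

Definition open_dense_in (T : topologicalType) (S D : set T) : Prop :=
  (exists2 V, open V & D = S `&` V) /\ S `<=` closure D.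

Section IntegrableSystems.
Variables (R : realType) (n : nat) (M : complex_manifold R (2 * n)).
Variable Omega : holomorphic_symplectic_form M.

Record real_integrable_system (N : set M) (u : 'I_n -> M -> R) : Prop :=
  RealIntegrableSystem {
    ris_commute : forall (g : chart R (2 * n) N) phi, analytic_chart g -> atlas phi ->
      forall t, ccod g t -> cdom phi (cinv g t) ->
      forall i j, poisson (induced_form Omega g phi t)
        (grad (u i \o cinv g) t) (grad (u j \o cinv g) t) = 0;
    ris_independent : exists2 D, open_dense_in N D &
      forall g : chart R (2 * n) N, analytic_chart g ->
      forall t, ccod g t -> D (cinv g t) ->
      independent_differentials (fun i => u i \o cinv g) t }.

Definition holomorphic_on (U : set M) (f : M -> R[i]) : Prop :=
  forall phi, atlas phi -> forall z, ccod phi z -> U (cinv phi z) ->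
  differentiable (f \o cinv phi : 'rV[R[i]]_(2 * n) -> R[i]^o) z.

(* On the open subset U of M, with the restriction of Omega. *)
Record holomorphic_integrable_system (U : set M) (v : 'I_n -> M -> R[i]) :
    Prop := HolomorphicIntegrableSystem {
  his_holomorphic : forall i, holomorphic_on U (v i);
  his_commute : forall phi, atlas phi ->
    forall z, ccod phi z -> U (cinv phi z) ->
    forall i j, poisson (Omega phi z)
      (grad (v i \o cinv phi) z) (grad (v j \o cinv phi) z) = 0;
  his_independent : exists2 D, open_dense_in U D &
    forall phi, atlas phi -> forall z, ccod phi z -> D (cinv phi z) ->
    independent_differentials (fun i => v i \o cinv phi) z }.

Record holomorphic_extensions (N : set M) (u : 'I_n -> M -> R) (U : set M)
    (v : 'I_n -> M -> R[i]) : Prop := HolomorphicExtensions {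
  ext_open : open U;
  ext_neighbourhood : N `<=` U;
  ext_components : forall x, U x ->
    connected_component U x `&` N !=set0;
  ext_holomorphic : forall i, holomorphic_on U (v i);
  ext_agree : forall i x, N x -> v i x = (u i x)%:C }.

End IntegrableSystems.

(* Main.v *)
(* Each of the two conclusions is controlled by an analytic subset of U: the
   points where all brackets of the v_i vanish, and the points where all maximal
   minors of the differentials of the v_i vanish.  Since N is totally real of
   half the dimension, a real frame of T_x N is a complex basis of T_x M, so a
   holomorphic function vanishing on N near x has vanishing differential along N,
   and by induction all its iterated derivatives vanish at x; by the Cauchy
   estimates it is zero near x.  The set of points near which all local equations
   vanish is open and closed in U, and hence is a union of components of U.  In a
   real frame the bracket and the differentials of the u_i are those of the v_i,
   so the brackets vanish near N, hence on the components of U, all of which meet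
   N; and if the v_i were dependent on a nonempty open set, they would be so near
   a point of N, contradicting the density of independence on N. *)

From HB Require Import structures.
Require Import Defs.
From mathcomp Require Import all_boot all_order all_algebra.
From mathcomp Require Import all_classical all_reals all_analysis.
From mathcomp Require Import complex ring lra.

Set Implicit Arguments.
Unset Strict Implicit.
Unset Printing Implicit Defensive.

Import Order.TTheory GRing.Theory Num.Theory.
Import numFieldNormedType.Exports.

Local Open Scope classical_set_scope.
Local Open Scope ring_scope.
Local Open Scope complex_scope.

Section RealNorm.
Variable R : realType.
Local Notation C := R[i].

(* The norm of a space over R[i] is valued in R[i]; this is its value in R. *)
Definition rnorm (V : normedZmodType C) (v : V) : R := complex.Re `|v|.

Section Normed.
Variable V : normedZmodType C.
Implicit Types u v w : V.

Lemma rnormE v : `|v| = (rnorm v)%:C.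
Proof.
by have := normr_real v; rewrite /rnorm; case: `|v| => a b; rewrite complex_real => /= /eqP ->.
Qed.

Lemma rnorm_ge0 v : 0 <= rnorm v.
Proof. by rewrite -(@lecR R) -rnormE normr_ge0. Qed.

Lemma rnorm0 : rnorm (0 : V) = 0.
Proof. by rewrite /rnorm normr0. Qed.

Lemma rnormN v : rnorm (- v) = rnorm v.
Proof. by rewrite /rnorm normrN. Qed.

Lemma rnormB u v : rnorm (u - v) = rnorm (v - u).
Proof. by rewrite -rnormN opprB. Qed.

Lemma ler_rnormD u v : rnorm (u + v) <= rnorm u + rnorm v.
Proof. by rewrite -(@lecR R) rmorphD /= -!rnormE ler_normD. Qed.

Lemma ler_rnormB u v : rnorm (u - v) <= rnorm u + rnorm v.
Proof. by rewrite -(rnormN v) ler_rnormD. Qed.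

Lemma rnorm_eq0 v : rnorm v = 0 -> v = 0.
Proof. by move=> v0; apply/normr0_eq0; rewrite rnormE v0. Qed.

Lemma rnorm_small0 v : (forall e, 0 < e -> rnorm v <= e) -> v = 0.
Proof.
move=> h; apply: rnorm_eq0; apply/eqP; rewrite eq_le rnorm_ge0 andbT.
by apply/ler_addgt0Pr => e /h; rewrite add0r.
Qed.

End Normed.

Lemma rnormM (x y : C) : rnorm (x * y) = rnorm x * rnorm y.
Proof. by apply: complexI; rewrite -rnormE normrM !rnormE -rmorphM. Qed.

Lemma rnorm1 : rnorm (1 : C) = 1.
Proof. by rewrite /rnorm normr1. Qed.

Lemma rnormV (x : C) : rnorm x^-1 = (rnorm x)^-1.
Proof.
have [->|x0] := eqVneq x 0; first by rewrite !invr0 rnorm0 invr0.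
have rx0 : rnorm x != 0 by apply: contra_neq x0; exact: rnorm_eq0.
by apply: (mulfI rx0); rewrite -rnormM !divff// rnorm1.
Qed.

Lemma rnormZ (V : normedModType C) (a : C) (v : V) :
  rnorm (a *: v) = rnorm a * rnorm v.
Proof. by apply: complexI; rewrite -rnormE normrZ !rnormE -rmorphM. Qed.

Lemma rnormC (x : R) : rnorm (x%:C) = `|x|.
Proof. by rewrite /rnorm normc_def /= expr0n addr0 sqrtr_sqr. Qed.

Lemma rnormi : rnorm ('i : C) = 1.
Proof. by rewrite /rnorm normc_def /= expr0n add0r expr1n sqrtr1. Qed.

Lemma ler_Re (z : C) : `|complex.Re z| <= rnorm z.
Proof.
rewrite /rnorm normc_def /= -sqrtr_sqr ler_wsqrtr// lerDl sqr_ge0//.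
Qed.

Lemma ler_Im (z : C) : `|complex.Im z| <= rnorm z.
Proof.
rewrite /rnorm normc_def /= -sqrtr_sqr ler_wsqrtr// lerDr sqr_ge0//.
Qed.

Lemma ler_rnormReIm (z : C) : rnorm z <= `|complex.Re z| + `|complex.Im z|.
Proof.
rewrite [in leLHS](complexE z); apply: (le_trans (ler_rnormD _ _)).
by rewrite rnormM rnormi mul1r !rnormC.
Qed.

Lemma gt0_realC (e : C) : 0 < e -> e = (complex.Re e)%:C /\ 0 < complex.Re e.
Proof. by case: e => a b; rewrite ltcE /= => /andP[/eqP -> ->]. Qed.

Section Filters.
Variable V : normedModType C.

Lemma nbhs_rnormP (p : V) (P : set V) :
  nbhs p P <-> exists2 d : R, 0 < d & forall x, rnorm (x - p) < d -> P x.
Proof.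
rewrite -nbhs_ballE; split => [[e /= e0 he]|[d d0 hd]].
  have [eE er] := gt0_realC e0; exists (complex.Re e) => // x xp.
  by apply: he; rewrite -ball_normE /= eE rnormE ltcR rnormB.
exists d%:C; first by rewrite /= ltcR.
by move=> x; rewrite -ball_normE /= rnormE ltcR rnormB; exact: hd.
Qed.

Lemma cvg_rnormP (T : Type) (F : set_system T) (FF : Filter F) (f : T -> V) (l : V) :
  f @ F --> l <-> forall e : R, 0 < e -> \forall x \near F, rnorm (f x - l) < e.
Proof.
split=> [fl e e0|h A /nbhs_rnormP[d d0 dA]]; last first.
  by rewrite /fmap; apply: filterS (h d d0) => x; exact: dA.
apply: (fl [set y | rnorm (y - l) < e]); apply/nbhs_rnormP; by exists e.
Qed.

End Filters.

End RealNorm.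

Section Differential.
Context {K : numFieldType} {V W : normedModType K}.

Lemma differentiable_near (f : V -> W) z : differentiable f z ->
  forall e, 0 < e ->
  \forall h \near (0 : V), `|f (z + h) - f z - 'd f z h| <= e * `|h|.
Proof.
move=> /diff_locally /eqaddoP fz e /fz; apply: filterS => h.
have -> // : (f \o shift z - (cst (f z) + 'd f z)) h = f (z + h) - f z - 'd f z h.
by rewrite -[LHS]/(f (h + z) - (f z + 'd f z h)) opprD addrA [h + z]addrC.
Qed.

Lemma near_is_diff (f : V -> W) (L : {linear V -> W}) z : continuous L ->
  (forall e, 0 < e ->
    \forall h \near (0 : V), `|f (z + h) - f z - L h| <= e * `|h|) ->
  is_diff z f L.
Proof.
move=> Lc Lz.
have fL : f \o shift z = cst (f z) + L +o_ 0 id.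
  apply/eqaddoP => e /Lz; apply: filterS => h.
  have -> // : (f \o shift z - (cst (f z) + L)) h = f (z + h) - f z - L h.
  by rewrite -[LHS]/(f (h + z) - (f z + L h)) opprD addrA [h + z]addrC.
have dL := diff_unique Lc fL.
by apply: DiffDef => //; apply/diff_locallyP; rewrite dL.
Qed.

End Differential.

Section ComplexDifferential.
Variable R : realType.
Local Notation C := R[i].
Context {V W : normedModType C}.

Lemma differentiable_rnorm (f : V -> W) z : differentiable f z ->
  forall e : R, 0 < e -> exists2 d : R, 0 < d & forall h, rnorm h < d ->
    rnorm (f (z + h) - f z - 'd f z h) <= e * rnorm h.
Proof.
move=> fz e e0; have eC : 0 < e%:C by rewrite ltcR.
have /nbhs_rnormP[d d0 hd] := differentiable_near fz eC.
exists d => // h hh; have := hd h; rewrite subr0 => /(_ hh).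
by rewrite !rnormE -rmorphM lecR.
Qed.

Lemma linear_continuous_rnorm (L : {linear V -> W}) (k : R) :
  (forall h, rnorm (L h) <= k * rnorm h) -> continuous L.
Proof.
move=> Lk x; apply/cvg_rnormP => e e0; apply/nbhs_rnormP.
have k0 : 0 < `|k| + 1 by rewrite ltr_wpDl.
exists (e / (`|k| + 1)); first by rewrite divr_gt0.
move=> y yx; rewrite -linearB (le_lt_trans (Lk _))//.
rewrite (@le_lt_trans _ _ ((`|k| + 1) * rnorm (y - x)))//.
  by rewrite ler_wpM2r ?rnorm_ge0// (le_trans (ler_norm k))// lerDl.
by rewrite mulrC -ltr_pdivlMr.
Qed.

Lemma rnorm_is_diff (f : V -> W) (L : {linear V -> W}) (k : R) z :
  (forall h, rnorm (L h) <= k * rnorm h) ->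
  (forall e : R, 0 < e -> exists2 d : R, 0 < d & forall h, rnorm h < d ->
    rnorm (f (z + h) - f z - L h) <= e * rnorm h) ->
  is_diff z f L.
Proof.
move=> Lk fL; apply: near_is_diff; first exact: linear_continuous_rnorm Lk.
move=> e /gt0_realC[-> /fL[d d0 hd]]; apply/nbhs_rnormP; exists d => // h.
by rewrite subr0 => /hd; rewrite !rnormE -rmorphM lecR.
Qed.

Lemma diff_bounded (f : V -> W) z : differentiable f z ->
  exists2 k : R, 0 < k & forall h, rnorm ('d f z h) <= k * rnorm h.
Proof.
move=> /diff_continuous/linear_lipschitz[k /gt0_realC[-> k0] hk].
exists (complex.Re k) => // h.
by rewrite -(@lecR R) rmorphM /= -!rnormE.
Qed.

End ComplexDifferential.

(** * Complex integration and Cauchy's formula *)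

Section ComplexIntegral.
Variable R : realType.
Local Notation C := R[i].
Local Notation mu := (@lebesgue_measure R).
Implicit Types (a b c t : R) (phi psi : R -> C).

Definition cont_at t phi :=
  {for t, continuous (fun s => complex.Re (phi s))} /\
  {for t, continuous (fun s => complex.Im (phi s))}.

Definition cont_on a b phi := forall t, a <= t <= b -> cont_at t phi.

Definition Cint a b phi : C :=
  (\int[mu]_(t in `[a, b]) complex.Re (phi t)) +i*
  (\int[mu]_(t in `[a, b]) complex.Im (phi t)).

Lemma cont_atP t phi : cont_at t phi <->
  forall e, 0 < e -> exists2 d, 0 < d &
    forall s, `|s - t| < d -> rnorm (phi s - phi t) < e.
Proof.
split=> [[/cvgrPdist_lt cr /cvgrPdist_lt ci] e e0|h].
  have e2 : 0 < e / 2 by rewrite divr_gt0.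
  have [d d0 hd] : \forall s \near t,
      `|complex.Re (phi t) - complex.Re (phi s)| < e / 2 /\
      `|complex.Im (phi t) - complex.Im (phi s)| < e / 2.
    by near=> s; split; near: s; [exact: cr|exact: ci].
  exists d => // s sd; have [|hr hi] := hd s; first by rewrite /ball_/= distrC.
  rewrite (le_lt_trans (ler_rnormReIm _))// (splitr e) !raddfB ltrD//.
    by rewrite distrC.
  by rewrite distrC.
split; apply/cvgrPdist_lt => e /h[d d0 hd]; exists d => // s; rewrite /ball_/= distrC => /hd;
  apply: le_lt_trans; rewrite rnormB /= -raddfB; [exact: ler_Re|exact: ler_Im].
Unshelve. all: by end_near. Qed.

Lemma cont_atD t phi psi : cont_at t phi -> cont_at t psi ->
  cont_at t (fun s => phi s + psi s).
Proof.
move=> [h1 h2] [h3 h4]; split; rewrite /prop_for /=.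
  under eq_fun do rewrite raddfD; exact: cvgD.
by under eq_fun do rewrite raddfD; exact: cvgD.
Qed.

Lemma cont_atM t phi psi : cont_at t phi -> cont_at t psi ->
  cont_at t (fun s => phi s * psi s).
Proof.
have hE (x y : C) : x * y = (complex.Re x * complex.Re y - complex.Im x * complex.Im y)
    +i* (complex.Re x * complex.Im y + complex.Im x * complex.Re y).
  by case: x => ? ?; case: y => ? ?; simpc.
move=> [h1 h2] [h3 h4]; split; rewrite /prop_for /=.
  by under eq_fun do rewrite hE /=; apply: cvgB; exact: cvgM.
by under eq_fun do rewrite hE /=; apply: cvgD; exact: cvgM.
Qed.

Lemma cont_at_cst t (z : C) : cont_at t (fun=> z).
Proof. by split; exact: cvg_cst. Qed.

Lemma cont_atZ t (z : C) phi : cont_at t phi -> cont_at t (fun s => z * phi s).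
Proof. by move=> h; apply: cont_atM => //; exact: cont_at_cst. Qed.

Lemma cont_atB t phi psi : cont_at t phi -> cont_at t psi ->
  cont_at t (fun s => phi s - psi s).
Proof.
move=> h1 h2; have -> : (fun s => phi s - psi s) = (fun s => phi s + -1 * psi s).
  by apply/funext => s; rewrite mulN1r.
by apply: cont_atD => //; apply: cont_atZ.
Qed.

Lemma cont_onB a b phi psi : cont_on a b phi -> cont_on a b psi ->
  cont_on a b (fun t => phi t - psi t).
Proof. by move=> h1 h2 t tab; apply: cont_atB; [exact: h1|exact: h2]. Qed.

Lemma cont_onZ a b (z : C) phi : cont_on a b phi ->
  cont_on a b (fun t => z * phi t).
Proof. by move=> h t tab; apply: cont_atZ; exact: h. Qed.

Lemma continuous_integrable a b (f : R -> R) :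
  (forall t, a <= t <= b -> {for t, continuous f}) ->
  mu.-integrable `[a, b] (EFin \o f).
Proof.
move=> fc; apply: continuous_compact_integrable; first exact: segment_compact.
by apply: continuous_in_subspaceT => t; rewrite inE /= in_itv /=; exact: fc.
Qed.

Lemma integrable_Re a b phi : cont_on a b phi ->
  mu.-integrable `[a, b] (EFin \o (fun t => complex.Re (phi t))).
Proof. by move=> h; apply: continuous_integrable => t /h[]. Qed.

Lemma integrable_Im a b phi : cont_on a b phi ->
  mu.-integrable `[a, b] (EFin \o (fun t => complex.Im (phi t))).
Proof. by move=> h; apply: continuous_integrable => t /h[]. Qed.

Lemma eq_Cint a b phi psi : (forall t, a <= t <= b -> phi t = psi t) ->
  Cint a b phi = Cint a b psi.
Proof.
move=> h; congr Complex; apply: eq_Rintegral => t;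
  by rewrite inE /= in_itv /= => /h ->.
Qed.

Lemma CintD a b phi psi : cont_on a b phi -> cont_on a b psi ->
  Cint a b (fun t => phi t + psi t) = Cint a b phi + Cint a b psi.
Proof.
move=> cp cs; have -> : Cint a b phi + Cint a b psi =
  (\int[mu]_(t in `[a, b]) complex.Re (phi t) + \int[mu]_(t in `[a, b]) complex.Re (psi t)) +i*
  (\int[mu]_(t in `[a, b]) complex.Im (phi t) + \int[mu]_(t in `[a, b]) complex.Im (psi t)) by [].
rewrite -!RintegralD//;
  try solve [exact: integrable_Re|exact: integrable_Im].
by congr Complex; apply: eq_Rintegral => t _; rewrite raddfD.
Qed.

Lemma CintZ a b (z : C) phi : cont_on a b phi ->
  Cint a b (fun t => z * phi t) = z * Cint a b phi.
Proof.
move=> cp; have [ip jp] := (integrable_Re cp, integrable_Im cp).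
have hZ (k : R) (f : R -> R) : mu.-integrable `[a, b] (EFin \o f) ->
    mu.-integrable `[a, b] (EFin \o (fun t => k * f t)).
  by move=> /(integrableZl _ k) h; apply: h.
case: z => x y.
have -> : (x +i* y) * Cint a b phi =
  (x * \int[mu]_(t in `[a, b]) complex.Re (phi t) -
   y * \int[mu]_(t in `[a, b]) complex.Im (phi t)) +i*
  (x * \int[mu]_(t in `[a, b]) complex.Im (phi t) +
   y * \int[mu]_(t in `[a, b]) complex.Re (phi t)) by [].
rewrite -!RintegralZl// -RintegralB//; try exact: hZ.
rewrite -RintegralD//; try exact: hZ.
by congr Complex; apply: eq_Rintegral => t _; case: (phi t).
Qed.

Lemma CintB a b phi psi : cont_on a b phi -> cont_on a b psi ->
  Cint a b (fun t => phi t - psi t) = Cint a b phi - Cint a b psi.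
Proof.
move=> cp cs; have <- : Cint a b (fun t => -1 * psi t) = - Cint a b psi.
  by rewrite CintZ// mulN1r.
rewrite -CintD; [|exact: cp|exact: cont_onZ].
by apply: eq_Cint => t _; rewrite mulN1r.
Qed.

Lemma Rint_cst a b k : a <= b -> \int[mu]_(t in `[a, b]) k = k * (b - a).
Proof.
move=> ab; rewrite Rintegral_cst//= lebesgue_measure_itv/= lte_fin.
by case: ltgtP ab => //= -> _; rewrite subrr.
Qed.

Lemma Cint_cst a b (z : C) : a <= b -> Cint a b (fun=> z) = (b - a)%:C * z.
Proof.
by move=> ab; rewrite /Cint !Rint_cst//; case: z => x y; simpc; rewrite ![_ * (b - a)]mulrC.
Qed.

Lemma Rint_split a b c (f : R -> R) : mu.-integrable `[a, b] (EFin \o f) ->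
  a <= c <= b ->
  \int[mu]_(t in `[a, b]) f t =
    \int[mu]_(t in `[a, c]) f t + \int[mu]_(t in `[c, b]) f t.
Proof.
move=> fi /andP[ac cb]; rewrite -(@Rintegral_itv_obnd_cbnd _ c)//; last first.
  by apply: integrableS fi => //; apply: subset_itvr; rewrite bnd_simp.
by rewrite -(@Rintegral_itvB _ f (BLeft a))//; ring.
Qed.

Lemma Cint_split a b c phi : cont_on a b phi -> a <= c <= b ->
  Cint a b phi = Cint a c phi + Cint c b phi.
Proof.
move=> cp acb; rewrite /Cint (Rint_split (integrable_Re cp) acb).
by rewrite (Rint_split (integrable_Im cp) acb).
Qed.

Lemma Rint_le a b k (f : R -> R) : a <= b -> mu.-integrable `[a, b] (EFin \o f) ->
  (forall t, a <= t <= b -> `|f t| <= k) ->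
  `|\int[mu]_(t in `[a, b]) f t| <= k * (b - a).
Proof.
move=> ab fi fk; apply: (le_trans (le_normr_Rintegral _ fi)) => //.
rewrite -Rint_cst//; apply: le_Rintegral => //.
- exact: (integrable_norm fi).
- by apply: continuous_integrable => t _; exact: cvg_cst.
Qed.

Lemma Cint_le a b (k : R) phi : a <= b -> cont_on a b phi ->
  (forall t, a <= t <= b -> rnorm (phi t) <= k) ->
  rnorm (Cint a b phi) <= 2 * k * (b - a).
Proof.
move=> ab cp pk; apply: (le_trans (ler_rnormReIm _)).
rewrite -mulrA mulrDl mul1r /Cint/= lerD//; apply: Rint_le => //.
- exact: integrable_Re.
- by move=> t tab; rewrite (le_trans (ler_Re _)) ?pk.
- exact: integrable_Im.
- by move=> t tab; rewrite (le_trans (ler_Im _)) ?pk.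
Qed.

End ComplexIntegral.

Section Bisection.
Variable R : realType.
Local Notation C := R[i].
Variables (L : R -> R -> R -> R -> C) (X1 X2 Y1 Y2 : R).
Hypotheses (X12 : X1 <= X2) (Y12 : Y1 <= Y2).

Let inside x1 x2 y1 y2 :=
  [/\ X1 <= x1, x1 <= x2, x2 <= X2 & [/\ Y1 <= y1, y1 <= y2 & y2 <= Y2]].

Hypothesis splitx : forall x1 x x2 y1 y2, inside x1 x2 y1 y2 -> x1 <= x <= x2 ->
  L x1 x2 y1 y2 = L x1 x y1 y2 + L x x2 y1 y2.
Hypothesis splity : forall x1 x2 y1 y y2, inside x1 x2 y1 y2 -> y1 <= y <= y2 ->
  L x1 x2 y1 y2 = L x1 x2 y1 y + L x1 x2 y y2.
Hypothesis local : forall x y, X1 <= x <= X2 -> Y1 <= y <= Y2 ->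
  forall e, 0 < e -> exists2 d, 0 < d & forall x1 x2 y1 y2, inside x1 x2 y1 y2 ->
    x1 <= x <= x2 -> y1 <= y <= y2 -> x2 - x1 < d -> y2 - y1 < d ->
    rnorm (L x1 x2 y1 y2) <= e * ((x2 - x1) + (y2 - y1)) ^+ 2.

Let w (k : nat) := (X2 - X1) / 2 ^+ k.
Let h (k : nat) := (Y2 - Y1) / 2 ^+ k.

Let big k (p : R * R) :=
  inside p.1 (p.1 + w k) p.2 (p.2 + h k) /\
  rnorm (L X1 X2 Y1 Y2) / 4 ^+ k <= rnorm (L p.1 (p.1 + w k) p.2 (p.2 + h k)).

Let wS k : w k = w k.+1 + w k.+1.
Proof. by rewrite /w exprS invfM; field. Qed.
Let hS k : h k = h k.+1 + h k.+1.
Proof. by rewrite /h exprS invfM; field. Qed.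
Let w0 k : 0 <= w k. Proof. by rewrite divr_ge0 ?exprn_ge0// subr_ge0. Qed.
Let h0 k : 0 <= h k. Proof. by rewrite divr_ge0 ?exprn_ge0// subr_ge0. Qed.

Let step k p : exists q : R * R, big k p ->
  [/\ big k.+1 q, p.1 <= q.1 <= p.1 + w k.+1 & p.2 <= q.2 <= p.2 + h k.+1].
Proof.
case: (pselect (big k p)) => [|nb]; last by exists p.
case: p => x y [[/= X1x xxw xwX [Y1y yyh yhY]] /= big0].
have I : inside x (x + w k) y (y + h k) by [].
have wE : x + w k = x + w k.+1 + w k.+1 by rewrite wS addrA.
have hE : y + h k = y + h k.+1 + h k.+1 by rewrite hS addrA.
have x1 : x <= x + w k.+1 by rewrite lerDl.
have x2 : x + w k.+1 <= x + w k by rewrite wE lerDl.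
have y1 : y <= y + h k.+1 by rewrite lerDl.
have y2 : y + h k.+1 <= y + h k by rewrite hE lerDl.
have X1x' := le_trans X1x x1; have Y1y' := le_trans Y1y y1.
have x2X := le_trans x2 xwX; have y2Y := le_trans y2 yhY.
have I1 : inside x (x + w k.+1) y (y + h k) by [].
have I2 : inside (x + w k.+1) (x + w k) y (y + h k) by [].
have b1 : x <= x + w k.+1 <= x + w k by rewrite x1.
have b2 : y <= y + h k.+1 <= y + h k by rewrite y1.
have xx : x <= x <= x + w k.+1 by rewrite lexx.
have yy : y <= y <= y + h k.+1 by rewrite lexx.
have xw : x <= x + w k.+1 <= x + w k.+1 by rewrite x1 lexx.
have yh : y <= y + h k.+1 <= y + h k.+1 by rewrite y1 lexx.
move: big0; rewrite (splitx I b1) (splity I1 b2) (splity I2 b2).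
have c4 : rnorm (L X1 X2 Y1 Y2) / 4 ^+ k = 4 * (rnorm (L X1 X2 Y1 Y2) / 4 ^+ k.+1).
  by rewrite exprS invfM; field.
rewrite {}c4; set c := rnorm (L X1 X2 Y1 Y2) / _ => big0.
have mk a b : x <= a <= x + w k.+1 -> y <= b <= y + h k.+1 ->
    inside a (a + w k.+1) b (b + h k.+1) ->
    c <= rnorm (L a (a + w k.+1) b (b + h k.+1)) ->
    exists q : R * R, big k (x, y) ->
      [/\ big k.+1 q, x <= q.1 <= x + w k.+1 & y <= q.2 <= y + h k.+1].
  by move=> ? ? ? ?; exists (a, b).
have [hA|hA] := leP c (rnorm (L x (x + w k.+1) y (y + h k.+1))).
  exact: mk hA.
have [hB|hB] := leP c (rnorm (L x (x + w k.+1) (y + h k.+1) (y + h k))).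
  by apply: (mk x (y + h k.+1)); rewrite -?hE.
have [hD|hD] := leP c (rnorm (L (x + w k.+1) (x + w k) y (y + h k.+1))).
  by apply: (mk (x + w k.+1) y); rewrite -?wE.
apply: (mk (x + w k.+1) (y + h k.+1)); rewrite -?wE -?hE//.
rewrite leNgt; apply/negP => hF; move: big0; apply/negP; rewrite -ltNge.
have -> : 4 * c = c + c + (c + c) by ring.
apply: (le_lt_trans (ler_rnormD _ _)); rewrite ltrD//.
  by rewrite (le_lt_trans (ler_rnormD _ _))// ltrD.
by rewrite (le_lt_trans (ler_rnormD _ _))// ltrD.
Qed.

Lemma bisection_eq0 : L X1 X2 Y1 Y2 = 0.
Proof.
apply/eqP/negPn/negP => L0.
have Lpos : 0 < rnorm (L X1 X2 Y1 Y2).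
  by rewrite lt_neqAle rnorm_ge0 andbT eq_sym; apply: contra_neq L0; exact: rnorm_eq0.
have /boolp.choice[f fP] : forall kp, exists q, big kp.1 kp.2 ->
    [/\ big kp.1.+1 q, kp.2.1 <= q.1 <= kp.2.1 + w kp.1.+1
      & kp.2.2 <= q.2 <= kp.2.2 + h kp.1.+1].
  by move=> [k p]; exact: step.
pose s := fix s k := if k is k'.+1 then f (k', s k') else (X1, Y1).
have sb k : big k (s k).
  elim: k => [|k ih]; last by have [] := fP (k, s k) ih.
  rewrite /big /= /w /h !expr0 !divr1 !subrKC; split=> //.
have s1 k : (s k).1 <= (s k.+1).1 <= (s k).1 + w k.+1 by have [] := fP (k, s k) (sb k).
have s2 k : (s k).2 <= (s k.+1).2 <= (s k).2 + h k.+1 by have [] := fP (k, s k) (sb k).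
have nested (u v : nat -> R) : (forall k, v k = v k.+1 + v k.+1) ->
    (forall k, 0 <= v k) ->
    (forall k, u k <= u k.+1 <= u k + v k.+1) ->
    exists z, forall k, u k <= z <= u k + v k.
  move=> vS v0 uv.
  have up k j : u (k + j)%N + v (k + j)%N <= u k + v k.
    elim: j => [|j ih]; first by rewrite addn0.
    rewrite addnS (le_trans _ ih)//; have := uv (k + j)%N; have := vS (k + j)%N; lra.
  have mono k j : u k <= u (k + j)%N.
    elim: j => [|j ih]; first by rewrite addn0.
    by rewrite addnS (le_trans ih)//; have := uv (k + j)%N; lra.
  have ub k : ubound (range u) (u k + v k).
    move=> _ [j _ <-]; case: (leqP k j) => [/subnKC <-|/ltnW /subnKC <-].
      by apply: le_trans (up k (j - k)%N); rewrite lerDl.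
    by apply: (le_trans (mono j (k - j)%N)); rewrite lerDl.
  exists (sup (range u)) => k; apply/andP; split.
    by apply: ub_le_sup; [exists (u 0%N + v 0%N); exact: ub|exists k].
  by apply: ge_sup => //; exists (u 0%N), 0%N.
have [x xP] := nested (fun k => (s k).1) w wS w0 s1.
have [y yP] := nested (fun k => (s k).2) h hS h0 s2.
have xX : X1 <= x <= X2 by have := xP 0%N; rewrite /= /w expr0 divr1; lra.
have yY : Y1 <= y <= Y2 by have := yP 0%N; rewrite /= /h expr0 divr1; lra.
pose S := (X2 - X1) + (Y2 - Y1).
have S0 : 0 <= S by rewrite addr_ge0 ?subr_ge0.
have e0 : 0 < rnorm (L X1 X2 Y1 Y2) / (2 * (S ^+ 2 + 1)).
  by rewrite divr_gt0// mulr_gt0// ltr_wpDl// sqr_ge0.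
have [d d0 hd] := local xX yY e0.
have [k kd] : exists k, S / 2 ^+ k < d.
  exists (Num.bound (S / d)); rewrite ltr_pdivrMr ?exprn_gt0// mulrC -ltr_pdivrMr//.
  apply: (lt_le_trans (archi_boundP _)); first by rewrite divr_ge0// ltW.
  by rewrite -natrX ler_nat ltnW// ltn_expl.
have wk : w k <= S / 2 ^+ k by rewrite ler_wpM2r ?invr_ge0 ?exprn_ge0// lerDl subr_ge0.
have hk : h k <= S / 2 ^+ k by rewrite ler_wpM2r ?invr_ge0 ?exprn_ge0// lerDr subr_ge0.
have [ik bk] := sb k.
have := hd _ _ _ _ ik (xP k) (yP k).
rewrite ![_ + _ - _]addrAC !subrr !add0r => /(_ (le_lt_trans wk kd) (le_lt_trans hk kd)).
apply/negP; rewrite -ltNge; apply: lt_le_trans bk.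
have -> : w k + h k = S / 2 ^+ k by rewrite /w /h -mulrDl.
have -> : (4 : R) ^+ k = (2 ^+ k) ^+ 2 by rewrite -exprM mulnC exprM; congr (_ ^+ k); ring.
rewrite exprMn exprVn mulrA ltr_pM2r ?invr_gt0 ?exprn_gt0//.
rewrite invfM -!mulrA gtr_pMr// ltr_pdivrMl// mulr1.
rewrite mulrC ltr_pdivrMr; last by rewrite ltr_wpDl// sqr_ge0.
have := sqr_ge0 S; lra.
Qed.

End Bisection.

Section Goursat.
Variable R : realType.
Local Notation C := R[i].
Implicit Types (F : C -> C) (z d : C).

Definition has_cderiv F z d := forall e : R, 0 < e -> exists2 r : R, 0 < r &
  forall h, rnorm h < r -> rnorm (F (z + h) - F z - d * h) <= e * rnorm h.

Lemma has_cderiv_cont F z d : has_cderiv F z d ->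
  forall e, 0 < e -> exists2 r, 0 < r &
    forall w, rnorm (w - z) < r -> rnorm (F w - F z) < e.
Proof.
move=> Fd e e0; have [r r0 hr] := Fd 1 ltr01.
have k0 : 0 < rnorm d + 1 by rewrite ltr_wpDl ?rnorm_ge0.
exists (Num.min r (e / (rnorm d + 1))); first by rewrite lt_min r0 divr_gt0.
move=> w; rewrite lt_min => /andP[/hr]; rewrite subrKC mul1r => h1 h2.
have -> : F w - F z = (F w - F z - d * (w - z)) + d * (w - z) by rewrite subrK.
rewrite (le_lt_trans (ler_rnormD _ _))// rnormM.
apply: (@le_lt_trans _ _ ((rnorm d + 1) * rnorm (w - z))).
  by rewrite mulrDl mul1r addrC lerD2l.
by rewrite mulrC -ltr_pdivlMr.
Qed.

Definition rect_int F x1 x2 y1 y2 : C :=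
  Cint x1 x2 (fun x => F (x +i* y1) - F (x +i* y2)) +
  'i * Cint y1 y2 (fun y => F (x2 +i* y) - F (x1 +i* y)).

Lemma has_cderiv_conth F x y d : has_cderiv F (x +i* y) d ->
  cont_at x (fun s => F (s +i* y)).
Proof.
move=> /has_cderiv_cont hF; apply/cont_atP => e /hF[r r0 hr].
exists r => // s sx; apply: hr; have -> : (s +i* y) - (x +i* y) = (s - x)%:C.
  by rewrite -[LHS]/((s - x) +i* (y - y)) subrr.
by rewrite rnormC.
Qed.

Lemma has_cderiv_contv F x y d : has_cderiv F (x +i* y) d ->
  cont_at y (fun s => F (x +i* s)).
Proof.
move=> /has_cderiv_cont hF; apply/cont_atP => e /hF[r r0 hr].
exists r => // s sx; apply: hr; have -> : (x +i* s) - (x +i* y) = 'i * (s - y)%:C.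
  by rewrite -[LHS]/((x - x) +i* (s - y)) subrr; simpc.
by rewrite rnormM rnormi mul1r rnormC.
Qed.

Lemma Goursat F X1 X2 Y1 Y2 : X1 <= X2 -> Y1 <= Y2 ->
  (forall x y, X1 <= x <= X2 -> Y1 <= y <= Y2 ->
    exists d, has_cderiv F (x +i* y) d) ->
  rect_int F X1 X2 Y1 Y2 = 0.
Proof.
move=> X12 Y12 Fd.
have ch y a b : X1 <= a -> b <= X2 -> Y1 <= y <= Y2 ->
    cont_on a b (fun s => F (s +i* y)).
  move=> Xa bX yY t /andP[at_ tb].
  have [|d /has_cderiv_conth//] := Fd t y _ yY.
  by rewrite (le_trans Xa at_) (le_trans tb bX).
have cv x a b : Y1 <= a -> b <= Y2 -> X1 <= x <= X2 ->
    cont_on a b (fun s => F (x +i* s)).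
  move=> Ya bY xX t /andP[at_ tb].
  have [|d /has_cderiv_contv//] := Fd x t xX _.
  by rewrite (le_trans Ya at_) (le_trans tb bY).
apply: bisection_eq0 => //.
- move=> x1 x x2 y1 y2 [Xx1 x12 x2X [Yy1 y12 y2Y]] xx; have /andP[x1x xx2] := xx.
  have hy1 : Y1 <= y1 <= Y2 by rewrite Yy1 (le_trans y12).
  have hy2 : Y1 <= y2 <= Y2 by rewrite y2Y (le_trans Yy1).
  have hx1 : X1 <= x1 <= X2 by rewrite Xx1 (le_trans x12).
  have hx2 : X1 <= x2 <= X2 by rewrite x2X (le_trans Xx1).
  have hx : X1 <= x <= X2 by rewrite (le_trans Xx1)// (le_trans xx2).
  rewrite /rect_int (Cint_split (c := x))//; last by apply: cont_onB; exact: ch.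
  have -> : Cint y1 y2 (fun y => F (x2 +i* y) - F (x1 +i* y)) =
     Cint y1 y2 (fun y => F (x +i* y) - F (x1 +i* y)) +
     Cint y1 y2 (fun y => F (x2 +i* y) - F (x +i* y)).
    rewrite -CintD; [|by apply: cont_onB; exact: cv|by apply: cont_onB; exact: cv].
    by apply: eq_Cint => y _; ring.
  by ring.
- move=> x1 x2 y1 y y2 [Xx1 x12 x2X [Yy1 y12 y2Y]] yy; have /andP[y1y yy2] := yy.
  have hy1 : Y1 <= y1 <= Y2 by rewrite Yy1 (le_trans y12).
  have hy2 : Y1 <= y2 <= Y2 by rewrite y2Y (le_trans Yy1).
  have hx1 : X1 <= x1 <= X2 by rewrite Xx1 (le_trans x12).
  have hx2 : X1 <= x2 <= X2 by rewrite x2X (le_trans Xx1).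
  have hy : Y1 <= y <= Y2 by rewrite (le_trans Yy1)// (le_trans yy2).
  rewrite /rect_int (@Cint_split _ y1 y2 y)//; last by apply: cont_onB; exact: cv.
  have -> : Cint x1 x2 (fun x => F (x +i* y1) - F (x +i* y2)) =
     Cint x1 x2 (fun x => F (x +i* y1) - F (x +i* y)) +
     Cint x1 x2 (fun x => F (x +i* y) - F (x +i* y2)).
    rewrite -CintD; [|by apply: cont_onB; exact: ch|by apply: cont_onB; exact: ch].
    by apply: eq_Cint => x _; ring.
  by ring.
move=> x0 y0 hx0 hy0 e e0; have [B FB] := Fd _ _ hx0 hy0.
have e8 : 0 < e / 8 by rewrite divr_gt0.
have [r r0 hr] := FB _ e8; exists (r / 2); first by rewrite divr_gt0.
move=> x1 x2 y1 y2 [Xx1 x12 x2X [Yy1 y12 y2Y]] xx yy xr yr.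
have hy1 : Y1 <= y1 <= Y2 by rewrite Yy1 (le_trans y12).
have hy2 : Y1 <= y2 <= Y2 by rewrite y2Y (le_trans Yy1).
have hx1 : X1 <= x1 <= X2 by rewrite Xx1 (le_trans x12).
have hx2 : X1 <= x2 <= X2 by rewrite x2X (le_trans Xx1).
set s := x2 - x1 + (y2 - y1).
(* F is affine up to rho, and the affine part has zero boundary integral. *)
pose rho (w : C) := F w - F (x0 +i* y0) - B * (w - (x0 +i* y0)).
have rhoP x y : x1 <= x <= x2 -> y1 <= y <= y2 -> rnorm (rho (x +i* y)) <= e / 8 * s.
  move=> xb yb; have ws : rnorm ((x +i* y) - (x0 +i* y0)) <= s.
    rewrite -[_ - _]/((x - x0) +i* (y - y0)) (le_trans (ler_rnormReIm _))//= /s lerD//.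
      by rewrite ler_norml; move: xb xx; clear; lra.
    by rewrite ler_norml; move: yb yy; clear; lra.
  have := hr ((x +i* y) - (x0 +i* y0)); rewrite subrKC => /(_ _)/le_trans; apply.
    by rewrite (le_lt_trans ws)// /s (splitr r) ltrD.
  by rewrite ler_pM2l.
have FE w : F w = rho w + (F (x0 +i* y0) + B * (w - (x0 +i* y0))).
  by rewrite /rho; ring.
rewrite /rect_int.
have c1 : cont_on x1 x2 (fun x => F (x +i* y1) - F (x +i* y2)).
  by apply: cont_onB; exact: ch.
have c2 : cont_on y1 y2 (fun y => F (x2 +i* y) - F (x1 +i* y)).
  by apply: cont_onB; exact: cv.
have cc u v (z : C) : cont_on u v (fun=> z) by move=> t _; exact: cont_at_cst.
set z1 := B * ('i * (y1 - y2)%:C); set z2 := B * (x2 - x1)%:C.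
have -> : Cint x1 x2 (fun x => F (x +i* y1) - F (x +i* y2)) =
    Cint x1 x2 (fun x => (F (x +i* y1) - F (x +i* y2)) - z1) + (x2 - x1)%:C * z1.
  by rewrite (CintB c1 (cc _ _ _)) Cint_cst// subrK.
have -> : Cint y1 y2 (fun y => F (x2 +i* y) - F (x1 +i* y)) =
    Cint y1 y2 (fun y => (F (x2 +i* y) - F (x1 +i* y)) - z2) + (y2 - y1)%:C * z2.
  by rewrite (CintB c2 (cc _ _ _)) Cint_cst// subrK.
set I1 := Cint x1 x2 _; set I2 := Cint y1 y2 _.
have -> : I1 + (x2 - x1)%:C * z1 + 'i * (I2 + (y2 - y1)%:C * z2) = I1 + 'i * I2.
  by rewrite /z1 /z2 !rmorphB /=; ring.
have b1 : rnorm I1 <= 2 * (e / 4 * s) * (x2 - x1).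
  apply: Cint_le => //; first exact: cont_onB.
  move=> x xb; have -> : F (x +i* y1) - F (x +i* y2) - z1 =
      rho (x +i* y1) - rho (x +i* y2).
    rewrite /z1 /rho; have -> : 'i * (y1 - y2)%:C = (x +i* y1) - (x +i* y2).
      by rewrite -[RHS]/((x - x) +i* (y1 - y2)) subrr; simpc.
    by ring.
  have -> : e / 4 * s = e / 8 * s + e / 8 * s by field.
  by rewrite (le_trans (ler_rnormB _ _))// lerD// rhoP// ?lexx ?y12.
have b2 : rnorm I2 <= 2 * (e / 4 * s) * (y2 - y1).
  apply: Cint_le => //; first exact: cont_onB.
  move=> y yb; have -> : F (x2 +i* y) - F (x1 +i* y) - z2 =
      rho (x2 +i* y) - rho (x1 +i* y).
    rewrite /z2 /rho; have -> : (x2 - x1)%:C = (x2 +i* y) - (x1 +i* y).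
      by rewrite -[RHS]/((x2 - x1) +i* (y - y)) subrr; simpc.
    by ring.
  have -> : e / 4 * s = e / 8 * s + e / 8 * s by field.
  by rewrite (le_trans (ler_rnormB _ _))// lerD// rhoP// ?lexx ?x12.
apply: (le_trans (ler_rnormD _ _)); rewrite rnormM rnormi mul1r.
apply: (le_trans (lerD b1 b2)); rewrite -mulrDr -/s expr2.
have -> : 2 * (e / 4 * s) * s = e / 2 * (s * s) by field.
by rewrite -expr2 ler_wpM2r ?sqr_ge0//; move: e0; clear; lra.
Qed.

End Goursat.

Section CauchyFormula.
Variable R : realType.
Local Notation C := R[i].

Lemma is_derive_eps (f : R -> R) (x d : R) : is_derive x 1 f d ->
  forall e, 0 < e -> exists2 r, 0 < r &
    forall h, `|h| < r -> `|f (x + h) - f x - d * h| <= e * `|h|.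
Proof.
move=> fd e e0; have fx : differentiable f x by apply/derivable1_diffP.
have /nbhs_ballP[r /= r0 hr] := differentiable_near fx e0.
exists r => // h hh; have := hr h; rewrite /ball /= sub0r normrN => /(_ hh).
have -> // : 'd f x h = d * h.
by rewrite diff1E//= derive1E (@derive_val _ _ _ _ _ _ _ fd) [LHS]mulrC.
Qed.

Definition circ (t : R) : C := cos t +i* sin t.

Definition cexp (w : C) : C := (expR (complex.Re w))%:C * circ (complex.Im w).

Lemma circD s t : circ (s + t) = circ s * circ t.
Proof. by rewrite /circ cosD sinD; simpc; congr Complex; ring. Qed.

Lemma circ0 : circ 0 = 1.
Proof. by rewrite /circ cos0 sin0. Qed.

Lemma rnorm_circ t : rnorm (circ t) = 1.
Proof. by rewrite /rnorm normc_def /= cos2Dsin2 sqrtr1. Qed.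

Lemma circ_cont t : cont_at t circ.
Proof. by split; [exact: continuous_cos|exact: continuous_sin]. Qed.

Lemma cexpD v w : cexp (v + w) = cexp v * cexp w.
Proof. by rewrite /cexp !raddfD expRD circD rmorphM /= mulrACA. Qed.

Lemma cexp0 : cexp 0 = 1.
Proof. by rewrite /cexp !raddf0 expR0 circ0 mulr1. Qed.

Lemma rnorm_cexp w : rnorm (cexp w) = expR (complex.Re w).
Proof. by rewrite rnormM rnorm_circ mulr1 rnormC ger0_norm// expR_ge0. Qed.

Lemma cexp_neq0 w : cexp w != 0.
Proof.
apply/eqP => w0; have := expR_gt0 (complex.Re w).
by rewrite -rnorm_cexp w0 rnorm0 ltxx.
Qed.

Lemma cexpN w : cexp (- w) = (cexp w)^-1.
Proof.
by apply: (mulfI (cexp_neq0 w)); rewrite -cexpD subrr cexp0 divff// cexp_neq0.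
Qed.

Lemma cexp_small e : 0 < e -> exists2 r : R, 0 < r & forall h : C, rnorm h < r ->
  rnorm (cexp h - 1 - h) <= e * rnorm h.
Proof.
move=> e0; pose d := Num.min 1 (e / 6).
have d0 : 0 < d by rewrite lt_min ltr01 divr_gt0.
have d1 : d <= 1 by rewrite ge_min lexx.
have d6 : 6 * d <= e by rewrite mulrC -ler_pdivlMr// ge_min lexx orbT.
have [r1 r10 h1] := is_derive_eps (is_derive_expR 0) d0.
have [r2 r20 h2] := is_derive_eps (is_derive_cos 0) d0.
have [r3 r30 h3] := is_derive_eps (is_derive_sin 0) d0.
exists (Num.min (Num.min r1 r2) (Num.min r3 (d / 2))).
  by rewrite !lt_min r10 r20 r30 divr_gt0.
case=> a b; rewrite !lt_min => /andP[/andP[n1 n2] /andP[n3 nd]].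
have ha := ler_Re (a +i* b); have hb := ler_Im (a +i* b); rewrite /= in ha hb.
have {h1} := h1 a (le_lt_trans ha n1); rewrite add0r expR0 mul1r => h1.
have {h2} := h2 b (le_lt_trans hb n2); rewrite add0r cos0 sin0 oppr0 mul0r subr0 => h2.
have {h3} := h3 b (le_lt_trans hb n3); rewrite add0r sin0 cos0 mul1r subr0 => h3.
have hs : `|sin b| <= 2 * `|b|.
  have -> : sin b = (sin b - b) + b by rewrite subrK.
  rewrite (le_trans (ler_normD _ _))// mulrDl mul1r lerD// (le_trans h3)//.
  by rewrite ler_piMl.
have he : `|expR a - 1| <= d.
  have -> : expR a - 1 = (expR a - 1 - a) + a by rewrite subrK.
  rewrite (le_trans (ler_normD _ _))// (splitr d) lerD//; last first.
    by rewrite (le_trans ha)// ltW.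
  rewrite (le_trans h1)// (le_trans (ler_wpM2l (ltW d0) ha))//.
  by rewrite (le_trans _ (ltW nd))// ler_piMl ?rnorm_ge0.
have hc := ler_norml (cos b) 1; rewrite cos_geN1 cos_le1 in hc.
have ha1 : `|a| <= 1.
  rewrite (le_trans ha)// ltW// (lt_le_trans nd)// ler_pdivrMr// mul1r.
  by rewrite (le_trans d1)// ler1n.
have -> : cexp (a +i* b) - 1 - (a +i* b) =
   ((expR a - 1 - a) * cos b + (1 + a) * (cos b - 1)) +i*
   ((expR a - 1) * sin b + (sin b - b)).
  by rewrite /cexp /circ /=; simpc; congr Complex; ring.
rewrite (le_trans (ler_rnormReIm _))//=.
apply: (@le_trans _ _ (6 * d * rnorm (a +i* b))); last first.
  by rewrite ler_wpM2r ?rnorm_ge0.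
apply: (@le_trans _ _ ((d * `|a| + 2 * (d * `|b|)) + (d * (2 * `|b|) + d * `|b|))).
  apply: lerD; rewrite (le_trans (ler_normD _ _))// !normrM lerD//.
  - by rewrite (le_trans _ h1)// ler_piMr// hc.
  - rewrite ler_pM// (le_trans (ler_normD _ _))// normr1.
    by rewrite -[leRHS]/(1 + 1) lerD2l.
  - by rewrite ler_pM.
have := ler_wpM2l (ltW d0) ha; have := ler_wpM2l (ltW d0) hb; clear; lra.
Qed.

Lemma has_cderiv_diff (F : C^o -> C^o) (z d : C^o) :
  has_cderiv F z d -> differentiable F z /\ 'd F z (1 : C^o) = d.
Proof.
move=> Fd; have lin : linear (fun h : C^o => d * h : C^o).
  by move=> k u v; rewrite mulrDr; congr (_ + _); exact: mulrCA.
pose L : {linear C^o -> C^o} := HB.pack (fun h : C^o => d * h : C^o)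
  (GRing.isLinear.Build C C^o C^o _ _ lin).
have [] // := @rnorm_is_diff R C^o C^o F L (rnorm d) z.
  by move=> h; rewrite -rnormM.
by move=> FD ->; split=> //; exact: mulr1.
Qed.

Lemma cderiv_differentiable (F : C^o -> C^o) (z d : C^o) :
  has_cderiv F z d -> differentiable F z.
Proof. by move=> /has_cderiv_diff[]. Qed.

Lemma cexp_differentiable (w : C^o) : differentiable (cexp : C^o -> C^o) w.
Proof.
apply: (@cderiv_differentiable _ _ (cexp w)).
move=> e e0; have [r r0 hr] := cexp_small (divr_gt0 e0 (expR_gt0 (complex.Re w))).
exists r => // h /hr; rewrite cexpD.
have -> : cexp w * cexp h - cexp w - cexp w * h = cexp w * (cexp h - 1 - h) by ring.
by rewrite rnormM rnorm_cexp -ler_pdivlMl ?expR_gt0// mulrA [_^-1 * e]mulrC.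
Qed.

Lemma linear_scale1 (W : lmodType C) (L : {linear C^o -> W}) (h : C^o) :
  L h = h *: L 1.
Proof. by rewrite -linearZ; congr (L _); rewrite -[LHS]mulr1. Qed.

Lemma differentiable_cderiv (F : C^o -> C^o) (z : C^o) :
  differentiable F z -> has_cderiv F z ('d F z (1 : C^o)).
Proof.
move=> Fz e e0; have [r r0 hr] := differentiable_rnorm Fz e0.
exists r => // h /hr; have -> // : 'd F z h = 'd F z (1 : C^o) * h.
by transitivity (h *: 'd F z (1 : C^o)); [exact: linear_scale1|exact: mulrC].
Qed.

(* The substitution s = exp w turns circles into vertical segments of length 2 pi;
   by Goursat and periodicity the integral of F along them does not depend on
   Re w, and it tends to 2 pi d as Re w goes to -oo. *)
Lemma Cauchy_deriv0 (f : C^o -> C^o) (S r : R) (d : C) : 0 < r < S ->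
  (forall s : C^o, rnorm s < S -> differentiable f s) -> has_cderiv f 0 d ->
  Cint 0 (pi *+ 2) (fun t => (f (r%:C * circ t) - f 0) * circ (- t)) =
    (r * pi *+ 2)%:C * d.
Proof.
move=> /andP[r0 rS] fS fd.
pose F (w : C^o) : C^o := (f (cexp w) - f 0) * cexp (- w).
pose A x := Cint 0 (pi *+ 2) (fun y => F (x +i* y)).
have pi2 : 0 <= pi *+ 2 :> R by rewrite mulrn_wge0// pi_ge0.
have Fd (w : C^o) : complex.Re w <= ln r -> exists d, has_cderiv F w d.
  move=> wr; exists ('d F w (1 : C^o)); apply: differentiable_cderiv.
  have fw : differentiable f (cexp w : C^o).
    apply: fS; rewrite rnorm_cexp (le_lt_trans _ rS)//.
    by rewrite -[leRHS]lnK ?posrE// ler_expR.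
  have h1 : differentiable (f \o (cexp : C^o -> C^o)) w.
    exact: (differentiable_comp (cexp_differentiable w) fw).
  have h2 : differentiable ((cexp : C^o -> C^o) \o (-%R : C^o -> C^o)) w.
    have hN : differentiable (-%R : C^o -> C^o) w.
      apply: (@cderiv_differentiable _ _ (-1)) => e e0; exists 1 => // h _.
      have -> : - (w + h) - - w - -1 * h = 0 :> C by ring.
      by rewrite rnorm0 mulr_ge0 ?rnorm_ge0// ltW.
    exact: (differentiable_comp hN (cexp_differentiable (- w))).
  exact: (differentiableM (differentiableB h1 (differentiable_cst (f 0) w)) h2).
have Fcont x : x <= ln r -> cont_on 0 (pi *+ 2) (fun y => F (x +i* y)).
  by move=> xr y _; have [|b /has_cderiv_contv] := Fd (x +i* y).
have Aconst x : x <= ln r -> A x = A (ln r).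
  move=> xr; have := @Goursat _ F x (ln r) 0 (pi *+ 2) xr pi2.
  move=> /(_ _) H0; have {H0} := H0 (fun a b ab _ => Fd (a +i* b) (proj2 (andP ab))).
  rewrite /rect_int => H; apply/eqP; rewrite eq_sym -subr_eq0; apply/eqP.
  rewrite /A -CintB; [|exact: Fcont|exact: Fcont].
  have i0 : 'i != 0 :> C by rewrite eq_complex /= oner_eq0 andbF.
  apply: (mulfI i0); rewrite mulr0 -[RHS]H.
  have -> : Cint x (ln r) (fun a => F (a +i* 0) - F (a +i* (pi *+ 2))) = 0.
    rewrite (@eq_Cint _ _ _ _ (fun=> 0)); first by rewrite Cint_cst// mulr0.
    move=> a _; have -> : F (a +i* (pi *+ 2)) = F (a +i* 0); last by rewrite subrr.
    have E : cexp (a +i* (pi *+ 2)) = cexp (a +i* 0).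
      by rewrite /cexp /circ /= cos2pi sin2pi cos0 sin0.
    by rewrite /F !cexpN E.
  by rewrite add0r.
have Ar : A (ln r) = r^-1%:C *
    Cint 0 (pi *+ 2) (fun t => (f (r%:C * circ t) - f 0) * circ (- t)).
  have cexpE t : cexp (ln r +i* t) = r%:C * circ t by rewrite /cexp /= lnK.
  have cexpEN t : cexp (- (ln r +i* t)) = r^-1%:C * circ (- t).
    by rewrite /cexp -[- (_ +i* _)]/((- ln r) +i* (- t)) /= expRN lnK.
  rewrite -CintZ.
    by apply: eq_Cint => t _; rewrite /F cexpE cexpEN mulrCA.
  move=> t tp; have := cont_atZ r%:C (Fcont _ (lexx _) t tp).
  congr cont_at; apply/funext => s; rewrite /F cexpE cexpEN; set u := f _ - f 0.
  have -> : r%:C * (u * (r^-1%:C * circ (- s))) =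
      (r%:C * r^-1%:C) * (u * circ (- s)) :> C by ring.
  by rewrite -rmorphM /= divff ?gt_eqF// mul1r.
suff AE : A (ln r) = (pi *+ 2)%:C * d.
  have := congr1 ( *%R r%:C) AE; rewrite Ar !mulrA -rmorphM /= divff ?gt_eqF// mul1r => ->.
  by rewrite -rmorphM /= mulrnAr.
apply/eqP; rewrite -subr_eq0; apply/eqP/rnorm_small0 => e e0.
have p0 : 0 < pi *+ 2 :> R by rewrite pmulrn_lgt0// pi_gt0.
have e2 : 0 < e / (2 * (pi *+ 2)) by rewrite divr_gt0// mulr_gt0.
have [q q0 hq] := fd _ e2.
pose x := Num.min (ln r) (ln (q / 2)).
have xr : x <= ln r by rewrite ge_min lexx.
have xq : expR x < q.
  apply: (@le_lt_trans _ _ (q / 2)); last by rewrite ltr_pdivrMr// ltr_pMr// ltr1n.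
  by rewrite -[leRHS]lnK ?posrE ?divr_gt0// ler_expR ge_min lexx orbT.
have -> : (pi *+ 2)%:C * d = Cint 0 (pi *+ 2) (fun=> d) by rewrite Cint_cst ?subr0.
have cd : cont_on 0 (pi *+ 2) (fun=> d) by move=> t _; exact: cont_at_cst.
rewrite -(Aconst x xr) /A -CintB//; last exact: Fcont.
have -> : e = 2 * (e / (2 * (pi *+ 2))) * (pi *+ 2 - 0).
  by rewrite subr0; move: (pi *+ 2) p0 => P P0; field; rewrite gt_eqF.
apply: Cint_le => //; first by apply: cont_onB => //; exact: Fcont.
move=> y _; set z := cexp (x +i* y).
have z0 : z != 0 := cexp_neq0 _.
have -> : F (x +i* y) - d = (f (0 + z) - f 0 - d * z) / z.
  by rewrite /F cexpN -/z add0r; field.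
have zq : rnorm z < q by rewrite rnorm_cexp.
rewrite rnormM rnormV ler_pdivrMr; first exact: hq.
by rewrite rnorm_cexp expR_gt0.
Qed.

End CauchyFormula.

Section MeanValue.
Variable R : realType.
Local Notation C := R[i].

Lemma cont_at_comp (F : C -> C) (g : R -> C) (t : R) (d : C) :
  cont_at t g -> has_cderiv F (g t) d -> cont_at t (fun s => F (g s)).
Proof.
move=> /cont_atP gt /has_cderiv_cont Ft; apply/cont_atP => e /Ft[r /gt[q q0 hq] hr].
by exists q => // s /hq /hr.
Qed.

Lemma cont_at_compN (g : R -> C) (t : R) :
  cont_at (- t) g -> cont_at t (fun s => g (- s)).
Proof.
move=> /cont_atP gt; apply/cont_atP => e /gt[q q0 hq]; exists q => // s st.
by apply: hq; rewrite -opprD normrN.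
Qed.

Lemma eps_is_derive (f : R -> R) (x d : R) :
  (forall e, 0 < e -> exists2 r, 0 < r &
    forall h, `|h| < r -> `|f (x + h) - f x - d * h| <= e * `|h|) ->
  is_derive x 1 f d.
Proof.
move=> fd; have lin : linear (fun h : R^o => d * h : R^o).
  by move=> k u v; rewrite mulrDr; congr (_ + _); exact: mulrCA.
pose L : {linear R^o -> R^o} := HB.pack (fun h : R^o => d * h : R^o)
  (GRing.isLinear.Build R R^o R^o _ _ lin).
have Lc : continuous L.
  by move=> h; apply: (@cvgM _ _ _ _ (cst d) id); [exact: cvg_cst|exact: cvg_id].
have [|] := @near_is_diff R R^o R^o f L x Lc.
  move=> e /fd[r r0 hr]; apply/nbhs_ballP; exists r => // h.
  by rewrite /ball /= sub0r normrN; exact: hr.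
move=> fx fE; apply: DeriveDef; first exact/derivable1_diffP.
by rewrite deriveE// fE; exact: mulr1.
Qed.

Lemma has_cderiv_Re (f : C -> C) (c d : C) (t : R) : has_cderiv f t%:C d ->
  is_derive t 1 (fun t : R => complex.Re (c * f t%:C)) (complex.Re (c * d)).
Proof.
move=> fd; apply: eps_is_derive => e e0.
have c0 : 0 < rnorm c + 1 by rewrite ltr_wpDl ?rnorm_ge0.
have [r r0 hr] := fd _ (divr_gt0 e0 c0); exists r => // h hh.
have := hr h%:C; rewrite rnormC => /(_ hh) {}hr.
have -> : complex.Re (c * f (t + h)%:C) - complex.Re (c * f t%:C) - complex.Re (c * d) * h
   = complex.Re (c * (f (t%:C + h%:C) - f t%:C - d * h%:C)).
  have -> : complex.Re (c * d) * h = complex.Re (c * (d * h%:C)).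
    by rewrite mulrA; case: (c * d) => u v; simpc.
  by rewrite -!raddfB /= rmorphD /= !mulrBr.
rewrite (le_trans (ler_Re _))// rnormM.
apply: (@le_trans _ _ ((rnorm c + 1) * (e / (rnorm c + 1) * `|h|))).
  by rewrite ler_pM ?rnorm_ge0// lerDl.
by rewrite mulrA mulrCA divff ?mulr1// gt_eqF.
Qed.

Lemma complex_mean_value (f : C -> C) (k : nat) (K : R) (df : C -> C) :
  (forall t : R, 0 <= t <= 1 -> has_cderiv f t%:C (df t%:C)) ->
  (forall t : R, 0 <= t <= 1 -> rnorm (df t%:C) <= K * t ^+ k) ->
  rnorm (f 1 - f 0) <= K / k.+1%:R.
Proof.
move=> fd dK; have [->|f0] := eqVneq (f 1 - f 0) 0.
  rewrite rnorm0 divr_ge0//.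
  by have := dK 1; rewrite expr1n mulr1 ler01 lexx => /(_ isT); exact/le_trans/rnorm_ge0.
set z := f 1 - f 0 in f0 *; pose c := (rnorm z)%:C / z.
have cz : c * z = (rnorm z)%:C by rewrite divfK.
have z0 : rnorm z != 0 by apply: contra_neq f0; exact: rnorm_eq0.
have c1 : rnorm c = 1.
  by rewrite rnormM rnormV rnormC ger0_norm ?rnorm_ge0// divff.
pose g t := complex.Re (c * f t%:C) - K / k.+1%:R * t ^+ k.+1.
have gd (t : R) : 0 <= t <= 1 -> is_derive t 1 g (complex.Re (c * df t%:C) - K * t ^+ k).
  move=> t01; have h1 := has_cderiv_Re c (fd t t01).
  have hX : is_derive t 1 (fun x : R => x ^+ k.+1) (k.+1%:R * t ^+ k).
    apply: DeriveDef; first exact: exprn_derivable.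
    by rewrite exp_derive; exact: mulr1.
  have hZ : is_derive t 1 (fun x : R => K / k.+1%:R * x ^+ k.+1) (K * t ^+ k).
    have -> : K * t ^+ k = K / k.+1%:R *: (k.+1%:R * t ^+ k).
      by rewrite -[RHS]/(_ * _) mulrA divfK// pnatr_eq0.
    exact: is_deriveZ.
  exact: is_deriveB.
have [||t t01 gE] := @MVT_segment R g (fun t => complex.Re (c * df t%:C) - K * t ^+ k) 0 1 ler01.
- by move=> t; rewrite in_itv/= => /andP[t0 t1]; apply: gd; rewrite !ltW.
- apply: continuous_in_subspaceT => t; rewrite inE/= in_itv/= => /gd gt.
  by apply: differentiable_continuous; apply/derivable1_diffP.
move: t01; rewrite in_itv/= => t01.
have : g 1 - g 0 <= 0.
  rewrite gE subr0 mulr1 subr_le0 (le_trans (ler_norm _))//.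
  by rewrite (le_trans (ler_Re _))// rnormM c1 mul1r dK.
rewrite /g expr1n mulr1 expr0n /= mulr0 subr0 addrAC -raddfB /= -mulrBr cz /=.
by rewrite subr_le0.
Qed.

End MeanValue.

(** * Holomorphic functions on a normed space *)

Section Holomorphic.
Variable R : realType.
Local Notation C := R[i].
Variables (V : normedModType C).
Implicit Types (f : V -> C^o) (p q w h : V).

Definition holo_ball f p (S : R) := forall q, rnorm (q - p) < S -> differentiable f q.

Lemma has_cderiv_line f p w (s : C) : differentiable f (p + s *: w) ->
  has_cderiv (fun s : C => f (p + s *: w)) s ('d f (p + s *: w) w).
Proof.
move=> fd e e0; have w0 : 0 < rnorm w + 1 by rewrite ltr_wpDl ?rnorm_ge0.
have [r r0 hr] := differentiable_rnorm fd (divr_gt0 e0 w0).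
exists (r / (rnorm w + 1)); first by rewrite divr_gt0.
move=> h hh; have {hr} := hr (h *: w).
have hw : rnorm (h *: w) <= rnorm h * (rnorm w + 1).
  by rewrite rnormZ ler_wpM2l ?rnorm_ge0// lerDl.
rewrite (le_lt_trans hw) -?ltr_pdivlMr// => /(_ isT).
have -> : 'd f (p + s *: w) (h *: w) = 'd f (p + s *: w) w * h.
  by rewrite linearZ; exact: mulrC.
rewrite scalerDl addrA => /le_trans; apply.
rewrite (le_trans (ler_wpM2l _ hw))//; first by rewrite divr_ge0// ltW.
have -> // : e / (rnorm w + 1) * (rnorm h * (rnorm w + 1)) = e * rnorm h.
by field; rewrite gt_eqF.
Qed.

Lemma holo_line f p w S (s : C^o) : holo_ball f p S -> rnorm w <= 1 ->
  rnorm s < S -> differentiable (fun s : C^o => f (p + s *: w)) s.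
Proof.
move=> fp w1 sS; apply: (cderiv_differentiable (has_cderiv_line _)).
apply: fp; rewrite addrAC subrr add0r rnormZ (le_lt_trans _ sS)//.
by rewrite ler_piMr ?rnorm_ge0.
Qed.

Lemma Cauchy_diff f p w (S r : R) : 0 < r < S -> holo_ball f p S ->
  rnorm w <= 1 ->
  Cint 0 (pi *+ 2) (fun t => (f (p + (r%:C * circ t) *: w) - f p) * circ (- t)) =
    (r * pi *+ 2)%:C * 'd f p w.
Proof.
move=> rS fp w1; have /andP[r0 rS'] := rS.
have := @Cauchy_deriv0 R (fun s : C^o => f (p + s *: w)) S r ('d f p w) rS.
rewrite scale0r addr0; apply.
  by move=> s sS; exact: holo_line sS.
have := @has_cderiv_line f p w 0; rewrite scale0r addr0; apply.
by apply: fp; rewrite subrr rnorm0 (lt_trans r0).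
Qed.

Lemma circle_cont f p w (S r t : R) : 0 < r < S -> holo_ball f p S ->
  rnorm w <= 1 -> cont_at t (fun t => f (p + (r%:C * circ t) *: w)).
Proof.
move=> /andP[r0 rS] fp w1.
have rc : cont_at t (fun t => r%:C * circ t) by apply: cont_atZ; exact: circ_cont.
apply: (cont_at_comp rc (has_cderiv_line _)).
 apply: fp; rewrite addrAC subrr add0r rnormZ rnormM.
rewrite rnorm_circ mulr1 rnormC ger0_norm ?ltW// (le_lt_trans _ rS)//.
by rewrite ler_piMr// ltW.
Qed.

Lemma Cauchy_estimate f p w (S M : R) : 0 < S -> holo_ball f p S ->
  (forall q, rnorm (q - p) < S -> rnorm (f q) <= M) ->
  rnorm ('d f p w) <= 8 * M / S * rnorm w.
Proof.
move=> S0 fp fM.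
have [->|w0] := eqVneq w 0.
  by rewrite linear0 !rnorm0 mulr0.
have wn0 : rnorm w != 0 by apply: contra_neq w0; exact: rnorm_eq0.
have wp : 0 < rnorm w by rewrite lt_neqAle eq_sym wn0 rnorm_ge0.
pose w' := (rnorm w)^-1%:C *: w.
have w'1 : rnorm w' = 1.
  by rewrite rnormZ rnormC ger0_norm ?invr_ge0 ?rnorm_ge0// mulVf.
suff h : rnorm ('d f p w') <= 8 * M / S.
  have -> : w = (rnorm w)%:C *: w' by rewrite scalerA -rmorphM /= divff// scale1r.
  rewrite linearZ /= rnormZ [in leRHS]rnormZ w'1 mulr1 mulrC rnormC ger0_norm ?rnorm_ge0//.
  by rewrite ler_wpM2r ?rnorm_ge0.
have rS : 0 < S / 2 < S by rewrite divr_gt0//= ltr_pdivrMr// ltr_pMr// ltr1n.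
have p0 : 0 < pi *+ 2 :> R by rewrite pmulrn_lgt0// pi_gt0.
have := Cauchy_diff rS fp (_ : rnorm w' <= 1); rewrite w'1 => /(_ (lexx _)) E.
have : rnorm ((S / 2 * pi *+ 2)%:C * 'd f p w') <= 2 * (2 * M) * (pi *+ 2 - 0).
  rewrite -E; apply: Cint_le; first exact: ltW.
    move=> t _; apply: cont_atM.
      apply: cont_atB; last exact: cont_at_cst.
      by apply: circle_cont rS fp _; rewrite w'1.
    exact: (cont_at_compN (circ_cont _)).
  move=> t _; rewrite rnormM rnorm_circ mulr1 (le_trans (ler_rnormB _ _))//.
  rewrite mulrDl mul1r lerD// fM//; last by rewrite subrr rnorm0.
  rewrite addrAC subrr add0r rnormZ rnormM rnorm_circ rnormC w'1 !mulr1.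
  by case/andP: rS => r0 rS; rewrite ger0_norm// ltW.
rewrite rnormM rnormC subr0 -mulrnAr.
have := rnorm_ge0 ('d f p w'); move: (rnorm _) => x x0.
rewrite ger0_norm; last by rewrite mulr_ge0 ?divr_ge0 ?(ltW S0) ?(ltW p0).
move: (pi *+ 2) p0 => P P0.
rewrite mulrAC ler_pM2r// => h; rewrite ler_pdivlMr//; move: h; clear -S0; lra.
Qed.

End Holomorphic.

Section HolomorphicRegularity.
Variable R : realType.
Local Notation C := R[i].
Variables (V : normedModType C).
Implicit Types (f : V -> C^o) (p q w h k : V).

Lemma holo_ball_sub f p q (S S' : R) : rnorm (q - p) + S' <= S ->
  holo_ball f p S -> holo_ball f q S'.
Proof.
move=> qp fp x xq; apply: fp; rewrite -(subrK q x) -addrA.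
rewrite (le_lt_trans (ler_rnormD _ _))// (lt_le_trans _ qp)// [ltLHS]addrC ltrD2l; exact: xq.
Qed.

Lemma bounded_ball_sub f p q (S S' M : R) : rnorm (q - p) + S' <= S ->
  (forall x, rnorm (x - p) < S -> rnorm (f x) <= M) ->
  forall x, rnorm (x - q) < S' -> rnorm (f x) <= M.
Proof.
move=> qp fp x xq; apply: fp; rewrite -(subrK q x) -addrA.
rewrite (le_lt_trans (ler_rnormD _ _))// (lt_le_trans _ qp)// [ltLHS]addrC ltrD2l; exact: xq.
Qed.

Lemma has_cderiv_ray f p h (t : R) : differentiable f (p + t%:C *: h) ->
  has_cderiv (fun s : C => f (p + s *: h)) t%:C ('d f (p + t%:C *: h) h).
Proof. exact: has_cderiv_line. Qed.

Lemma holo_lipschitz f p (S M : R) q h : 0 < S -> holo_ball f p S ->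
  (forall x, rnorm (x - p) < S -> rnorm (f x) <= M) ->
  rnorm (q - p) < S / 2 -> rnorm (q + h - p) < S / 2 ->
  rnorm (f (q + h) - f q) <= 16 * M / S * rnorm h.
Proof.
move=> S0 fp fM qS qhS.
have seg (t : R) : 0 <= t <= 1 -> rnorm (q + t%:C *: h - p) < S / 2.
  move=> /andP[t0 t1].
  have -> : q + t%:C *: h - p = (1 - t)%:C *: (q - p) + t%:C *: (q + h - p).
    have -> : q + h - p = (q - p) + h by rewrite addrAC.
    rewrite (scalerDr t%:C (q - p) h) addrA -scalerDl -rmorphD /= subrK scale1r.
    by rewrite addrAC.
  rewrite (le_lt_trans (ler_rnormD _ _))// !rnormZ !rnormC !ger0_norm ?subr_ge0//.
  have [->|tN1] := eqVneq t 1; first by rewrite subrr mul0r add0r mul1r.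
  have t1' : 0 < 1 - t by rewrite subr_gt0 lt_neqAle tN1.
  have -> : S / 2 = (1 - t) * (S / 2) + t * (S / 2) by ring.
  by rewrite ltr_leD// ?ltr_pM2l// ler_wpM2l// ltW.
have := @complex_mean_value R (fun s => f (q + s *: h)) 0 (16 * M / S * rnorm h)
  (fun s => 'd f (q + s *: h) h).
rewrite scale1r scale0r addr0 divr1; apply.
- move=> t t01; apply: has_cderiv_ray; apply: fp; rewrite (lt_trans (seg t t01))//.
  by rewrite ltr_pdivrMr// ltr_pMr// ltr1n.
- move=> t t01; rewrite expr0 mulr1.
  have bS : rnorm (q + t%:C *: h - p) + S / 2 <= S.
    by rewrite -lerBrDr; have := seg t t01; move: S0; clear; lra.
  have S2 : 0 < S / 2 by rewrite divr_gt0.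
  have := Cauchy_estimate h S2 (holo_ball_sub bS fp) (bounded_ball_sub bS fM).
  by have -> : 8 * M / (S / 2) = 16 * M / S by field; rewrite gt_eqF.
Qed.

Lemma is_diff_shift f q k : differentiable f (q + k) ->
  is_diff q (fun x => f (x + k)) ('d f (q + k)).
Proof.
move=> fd; have [K _ hK] := diff_bounded fd.
apply: (rnorm_is_diff hK) => e e0.
have [d d0 hd] := differentiable_rnorm fd e0; exists d => // h /hd.
by rewrite [q + k + h]addrAC.
Qed.

Lemma is_diff_val (F dF : V -> C^o) q w : is_diff q F dF -> 'd F q w = dF w.
Proof. by case=> _ ->. Qed.

Lemma diff_lipschitz f p (S M : R) q h w : 0 < S -> holo_ball f p S ->
  (forall x, rnorm (x - p) < S -> rnorm (f x) <= M) ->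
  rnorm (q - p) < S / 8 -> rnorm h < S / 8 ->
  rnorm ('d f (q + h) w - 'd f q w) <= 512 * M / S ^+ 2 * rnorm h * rnorm w.
Proof.
move=> S0 fp fM qS hS.
have S4 : 0 < S / 4 by rewrite divr_gt0.
have S2S : S / 2 < S by move: S0; clear; lra.
have in1 x : rnorm (x - q) < S / 4 -> rnorm (x - p) < S / 2.
  move=> xq; rewrite -(subrK q x) -addrA (le_lt_trans (ler_rnormD _ _))//.
  by move: (ltrD xq qS) S0; clear; lra.
have in2 x : rnorm (x - q) < S / 4 -> rnorm (x + h - p) < S / 2.
  move=> xq; have -> : x + h - p = (x - q) + (q - p) + h by rewrite subrKA addrAC.
  rewrite (le_lt_trans (ler_rnormD _ _))// (le_lt_trans (lerD (ler_rnormD _ _) (lexx _)))//.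
  by move: (ltrD (ltrD xq qS) hS) S0; clear; lra.
pose df x : V -> C^o := 'd f x.
have gd x : rnorm (x - q) < S / 4 ->
    is_diff x ((fun x => f (x + h)) - f) (df (x + h) - df x).
  move=> xq; apply: is_diffB; first exact: is_diff_shift (fp _ (lt_trans (in2 x xq) S2S)).
  by apply: DiffDef => //; apply: fp; rewrite (lt_trans (in1 x xq)).
have gh : holo_ball ((fun x => f (x + h)) - f) q (S / 4) by move=> x /gd[].
have C1 := @Cauchy_estimate _ _ _ _ w _ (16 * M / S * rnorm h) S4 gh.
have E : is_diff q ((fun x => f (x + h)) - f) (df (q + h) - df q).
  by apply: gd; rewrite subrr rnorm0.
have <- : 'd ((fun x => f (x + h)) - f) q w = 'd f (q + h) w - 'd f q w.
  exact: is_diff_val E.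
have -> : 512 * M / S ^+ 2 * rnorm h * rnorm w =
    8 * (16 * M / S * rnorm h) / (S / 4) * rnorm w by field; rewrite gt_eqF.
apply: C1 => x xq; apply: (holo_lipschitz S0 fp fM); first exact: in1.
exact: in2.
Qed.

Lemma second_order_bound f p (S M : R) h : 0 < S -> holo_ball f p S ->
  (forall x, rnorm (x - p) < S -> rnorm (f x) <= M) -> rnorm h < S / 8 ->
  rnorm (f (p + h) - f p - 'd f p h) <= 256 * M / S ^+ 2 * rnorm h ^+ 2.
Proof.
move=> S0 fp fM hS.
have := @complex_mean_value R (fun s => f (p + s *: h) - s * 'd f p h) 1
  (512 * M / S ^+ 2 * rnorm h ^+ 2) (fun s => 'd f (p + s *: h) h - 'd f p h).
rewrite scale1r scale0r addr0 mul1r mul0r subr0 addrAC.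
have -> : 512 * M / S ^+ 2 * rnorm h ^+ 2 / 2 = 256 * M / S ^+ 2 * rnorm h ^+ 2.
  by field; rewrite gt_eqF.
apply=> t /andP[t0 t1].
  have dt : differentiable f (p + t%:C *: h).
    apply: fp; rewrite addrAC subrr add0r rnormZ rnormC ger0_norm//.
    have := ler_piMl (rnorm_ge0 h) t1; move: hS S0; clear; lra.
  move=> e /(has_cderiv_ray dt)[r r0 hr]; exists r => // k /hr.
  by congr (rnorm _ <= _); ring.
have S8 : 0 < S / 8 by rewrite divr_gt0.
rewrite expr1; have tS : rnorm (t%:C *: h) <= t * rnorm h.
  by rewrite rnormZ rnormC ger0_norm.
have := @diff_lipschitz f p S M p (t%:C *: h) h S0 fp fM.
rewrite subrr rnorm0 => /(_ S8) H; apply: (le_trans (H _)).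
  by rewrite (le_lt_trans tS)// (le_lt_trans _ hS)// ler_piMl// rnorm_ge0.
rewrite rnormZ rnormC ger0_norm//.
by rewrite le_eqVlt; apply/orP; left; apply/eqP; ring.
Qed.

Lemma diff_circle_cont f p w (S M r : R) : 0 < S -> holo_ball f p S ->
  (forall x, rnorm (x - p) < S -> rnorm (f x) <= M) -> rnorm w <= 1 ->
  0 < r < S / 2 -> forall h t,
  cont_at t (fun t => 'd f (p + (r%:C * circ t) *: w) h : C).
Proof.
move=> S0 fp fM w1 /andP[r0 rS] h t; pose z t := (r%:C * circ t) *: w.
have zS t' : rnorm (z t') < S / 2.
  rewrite rnormZ rnormM rnorm_circ mulr1 rnormC ger0_norm ?(ltW r0)//.
  by rewrite (le_lt_trans _ rS)// ler_piMr// ltW.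
pose K := 512 * M / (S / 2) ^+ 2 * rnorm h.
have S2 : 0 < S / 2 by rewrite divr_gt0.
have bS : rnorm (p + z t - p) + S / 2 <= S.
  by rewrite addrAC subrr add0r; have := zS t; move: S0; clear; lra.
have K0 : 0 < `|K| + 1 by rewrite ltr_wpDl.
apply/cont_atP => e e0.
have rc : cont_at t (fun t => r%:C * circ t) by apply: cont_atZ; exact: circ_cont.
have d0 : 0 < Num.min (S / 16) (e / (`|K| + 1)) by rewrite lt_min !divr_gt0.
have [d dpos hd] := (cont_atP _ _).1 rc _ d0; exists d => // s /hd sd.
have zz : rnorm (z s - z t) < Num.min (S / 16) (e / (`|K| + 1)).
  by rewrite -scalerBl rnormZ (le_lt_trans _ sd)// ler_piMr// rnorm_ge0.
have -> : p + (r%:C * circ s) *: w = (p + z t) + (z s - z t) by rewrite -addrA subrKC.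
move: zz; rewrite lt_min => /andP[z1 z2].
have := @diff_lipschitz f (p + z t) (S / 2) M (p + z t) (z s - z t) h S2
  (holo_ball_sub bS fp) (bounded_ball_sub bS fM).
rewrite subrr rnorm0 => /(_ _ _)/le_lt_trans; apply.
- by rewrite divr_gt0.
- by rewrite (lt_le_trans z1)//; move: S0; clear; lra.
rewrite mulrAC -/K (@le_lt_trans _ _ ((`|K| + 1) * rnorm (z s - z t)))//.
  by rewrite ler_wpM2r ?rnorm_ge0// (le_trans (ler_norm _))// lerDl.
by rewrite mulrC -ltr_pdivlMr.
Qed.

(* Differentiation of Cauchy_diff under the integral sign. *)
Lemma differentiable_diff_unit f p w (S M : R) : 0 < S -> holo_ball f p S ->
  (forall x, rnorm (x - p) < S -> rnorm (f x) <= M) -> rnorm w <= 1 ->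
  differentiable (fun q => 'd f q w : C^o) p.
Proof.
move=> S0 fp fM w1; pose r := S / 4.
have S2 : 0 < S / 2 by rewrite divr_gt0.
have rS2 : 0 < r < S / 2.
  by rewrite /r; apply/andP; split; move: S0; clear; lra.
have /andP[r0 rS] := rS2.
pose z t := (r%:C * circ t) *: w.
have zr t : rnorm (z t) <= r.
  rewrite rnormZ rnormM rnorm_circ mulr1 rnormC ger0_norm ?(ltW r0)//.
  by rewrite ler_piMr// ltW.
have p2 : 0 < pi *+ 2 :> R by rewrite pmulrn_lgt0// pi_gt0.
have rp0 : 0 < r * pi *+ 2 by rewrite -mulrnAr mulr_gt0.
pose k : C := (r * pi *+ 2)%:C.
have k0 : k != 0 by rewrite eq_complex /= eqxx andbT gt_eqF.
pose G h t : C := ('d f (p + z t) h - 'd f p h) * circ (- t).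
have Gc h : cont_on 0 (pi *+ 2) (G h).
  move=> t _; apply: cont_atM; last exact: (cont_at_compN (circ_cont _)).
  by apply: cont_atB; [exact: diff_circle_cont S0 fp fM w1 rS2 h t|exact: cont_at_cst].
pose Lf h : C^o := k^-1 * Cint 0 (pi *+ 2) (G h).
have Llin : linear Lf.
  move=> a u v; change (Lf (a *: u + v) = a * Lf u + Lf v :> C).
  have -> : a * Lf u + Lf v = k^-1 * (a * Cint 0 (pi *+ 2) (G u) + Cint 0 (pi *+ 2) (G v)).
    by rewrite /Lf mulrDr mulrCA.
  rewrite -(CintZ a (Gc u)) -CintD; [|exact: cont_onZ|exact: Gc].
  congr (_ * _); apply: eq_Cint => t _; rewrite /G.
  have dlin q : 'd f q (a *: u + v) = a * 'd f q u + 'd f q v :> C by exact: linearP.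
  by rewrite !dlin; ring.
pose L : {linear V -> C^o} := HB.pack Lf (GRing.isLinear.Build C V C^o _ _ Llin).
have ballS q : rnorm (q - p) <= r -> rnorm (q - p) + S / 2 <= S.
  by rewrite /r; move: S0; clear; lra.
have pzS t : rnorm (p + z t - p) + S / 2 <= S.
  by apply: ballS; rewrite addrAC subrr add0r.
have ppS : rnorm (p - p) + S / 2 <= S.
  by apply: ballS; rewrite subrr rnorm0 ltW.
have dz t h : rnorm ('d f (p + z t) h) <= 8 * M / (S / 2) * rnorm h.
  exact: (Cauchy_estimate h S2 (holo_ball_sub (pzS t) fp) (bounded_ball_sub (pzS t) fM)).
have dp h : rnorm ('d f p h) <= 8 * M / (S / 2) * rnorm h.
  exact: (Cauchy_estimate h S2 (holo_ball_sub ppS fp) (bounded_ball_sub ppS fM)).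
have kn : 0 < rnorm k by rewrite rnormC ger0_norm// ltW.
have [] // := @rnorm_is_diff R V C^o (fun q => 'd f q w : C^o) L
  ((rnorm k)^-1 * (2 * (16 * M / (S / 2)) * (pi *+ 2))) p.
  move=> h; rewrite -[L h]/(Lf h) /Lf rnormM rnormV -!mulrA ler_pM2l ?invr_gt0//.
  have -> : 2 * (16 * (M * ((S / 2)^-1 * (pi *+ 2 * rnorm h)))) =
     2 * (16 * M / (S / 2) * rnorm h) * (pi *+ 2 - 0) by rewrite subr0; ring.
  apply: Cint_le => //; first exact: ltW.
  move=> t _; rewrite rnormM rnorm_circ mulr1 (le_trans (ler_rnormB _ _))//.
  have -> : 16 * M / (S / 2) * rnorm h =
    8 * M / (S / 2) * rnorm h + 8 * M / (S / 2) * rnorm h by ring.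
  by rewrite lerD.
move=> e e0; pose K := 256 * M / (S / 2) ^+ 2.
have K0 : 0 <= K.
  rewrite divr_ge0 ?sqr_ge0// mulr_ge0// (le_trans (rnorm_ge0 (f p)))// fM//.
  by rewrite subrr rnorm0.
pose K' := (rnorm k)^-1 * (2 * (2 * K) * (pi *+ 2)) + 1.
have K'0 : 0 < K'.
  rewrite ltr_wpDl// mulr_ge0 ?invr_ge0 ?(ltW kn)// mulr_ge0 ?(ltW p2)//.
  by rewrite mulr_ge0// mulr_ge0.
exists (Num.min (S / 16) (e / K')); first by rewrite lt_min !divr_gt0.
move=> h; rewrite lt_min => /andP[hS he].
pose rho t : C := ((f (p + z t + h) - f (p + z t) - 'd f (p + z t) h) -
  (f (p + h) - f p - 'd f p h)) * circ (- t).
have ph : rnorm (p + h - p) <= r.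
  by rewrite addrAC subrr add0r /r; move: hS S0; clear; lra.
have Cau q : rnorm (q - p) <= r ->
    Cint 0 (pi *+ 2) (fun t => (f (q + z t) - f q) * circ (- t)) = k * 'd f q w.
  by move=> qr; apply: Cauchy_diff rS2 (holo_ball_sub (ballS q qr) fp) w1.
have Cc q : rnorm (q - p) <= r ->
    cont_on 0 (pi *+ 2) (fun t => (f (q + z t) - f q) * circ (- t)).
  move=> qr t _; apply: cont_atM; last exact: (cont_at_compN (circ_cont _)).
  apply: cont_atB; last exact: cont_at_cst.
  exact: circle_cont rS2 (holo_ball_sub (ballS q qr) fp) w1.
have pp : rnorm (p - p) <= r by rewrite subrr rnorm0 ltW.
have rhoE : 'd f (p + h) w - 'd f p w - L h = k^-1 * Cint 0 (pi *+ 2) rho.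
  apply: (mulfI k0); rewrite mulrA divff// mul1r !mulrBr.
  rewrite -[L h]/(k^-1 * Cint 0 (pi *+ 2) (G h)) mulrA divff// mul1r.
  rewrite -(Cau _ ph) -(Cau _ pp) -CintB; [|exact: Cc|exact: Cc].
  rewrite -CintB; [|by apply: cont_onB; exact: Cc|exact: Gc].
  by apply: eq_Cint => t _; rewrite /rho /G [p + h + z t]addrAC; ring.
have rhoc : cont_on 0 (pi *+ 2) rho.
  have -> : rho = (fun t => ((f (p + h + z t) - f (p + h)) * circ (- t) -
      (f (p + z t) - f p) * circ (- t)) - G h t).
    by apply/funext => t; rewrite /rho /G [p + h + z t]addrAC; ring.
  by apply: cont_onB => //; apply: cont_onB; exact: Cc.
have so q : rnorm (q - p) <= r ->
    rnorm (f (q + h) - f q - 'd f q h) <= K * rnorm h ^+ 2.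
  move=> qr; apply: (second_order_bound S2 (holo_ball_sub (ballS q qr) fp)).
    exact: bounded_ball_sub (ballS q qr) fM.
  by rewrite (lt_le_trans hS)//; move: S0; clear; lra.
rewrite rhoE rnormM rnormV.
have : rnorm (Cint 0 (pi *+ 2) rho) <= 2 * (2 * (K * rnorm h ^+ 2)) * (pi *+ 2 - 0).
  apply: Cint_le => //; first exact: ltW.
  move=> t _; rewrite rnormM rnorm_circ mulr1 (le_trans (ler_rnormB _ _))//.
  rewrite mulrDl mul1r lerD// so//.
  by have := zr t; rewrite addrAC subrr add0r.
move=> /(ler_wpM2l (_ : 0 <= (rnorm k)^-1)); rewrite invr_ge0 rnorm_ge0 => /(_ isT)/le_trans; apply.
rewrite subr0; apply: (@le_trans _ _ (K' * rnorm h * rnorm h)).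
  have -> : (rnorm k)^-1 * (2 * (2 * (K * rnorm h ^+ 2)) * (pi *+ 2)) =
    (rnorm k)^-1 * (2 * (2 * K) * (pi *+ 2)) * rnorm h * rnorm h by ring.
  by rewrite ler_wpM2r ?rnorm_ge0// ler_wpM2r ?rnorm_ge0// lerDl.
by rewrite ler_wpM2r ?rnorm_ge0// mulrC -ler_pdivlMr// ltW.
Qed.

Lemma locally_bounded f p (S : R) : 0 < S -> holo_ball f p S ->
  exists2 S', 0 < S' <= S & exists M : R, forall x, rnorm (x - p) < S' -> rnorm (f x) <= M.
Proof.
move=> S0 fp; have fc : {for p, continuous f}.
  by apply: differentiable_continuous; apply: fp; rewrite subrr rnorm0.
have [d d0 hd] := (nbhs_rnormP _ _).1 ((cvg_rnormP _ _ _).1 fc 1 ltr01).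
exists (Num.min d S); first by rewrite lt_min d0 S0 ge_min lexx orbT.
exists (rnorm (f p) + 1) => x; rewrite lt_min => /andP[/hd xd _].
rewrite -(subrK (f p) (f x)) addrC (le_trans (ler_rnormD _ _))// lerD2l.
exact: ltW.
Qed.

Lemma differentiable_diff f p w (S : R) : 0 < S -> holo_ball f p S ->
  differentiable (fun q => 'd f q w : C^o) p.
Proof.
move=> S0 fp; have [S' /andP[S'0 S'S] [M fM]] := locally_bounded S0 fp.
have fp' : holo_ball f p S'.
  by apply: holo_ball_sub fp; rewrite subrr rnorm0 add0r.
have w0 : 0 < rnorm w + 1 by rewrite ltr_wpDl ?rnorm_ge0.
pose c : C := (rnorm w + 1)%:C.
have c0 : c != 0 by rewrite eq_complex /= eqxx andbT gt_eqF.
have w1 : rnorm (c^-1 *: w) <= 1.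
  by rewrite rnormZ rnormV rnormC gtr0_norm// ler_pdivrMl// mulr1 lerDl.
have := differentiableZ c (differentiable_diff_unit S'0 fp' fM w1).
have -> // : c *: (fun q => 'd f q (c^-1 *: w) : C^o) = (fun q => 'd f q w : C^o).
apply/funext => q; transitivity ('d f q (c *: (c^-1 *: w))).
  by symmetry; exact: linearZ.
by rewrite scalerA divff// scale1r.
Qed.

Lemma holo_ball_diff f p w (S : R) : holo_ball f p S ->
  holo_ball (fun q => 'd f q w : C^o) p S.
Proof.
move=> fp q qS; apply: (@differentiable_diff f q w (S - rnorm (q - p))).
  by rewrite subr_gt0.
by apply: holo_ball_sub fp; rewrite subrKC.
Qed.

End HolomorphicRegularity.

Section Flat.
Variable R : realType.
Local Notation C := R[i].

(* phi j is the j-th derivative of phi 0; every one of the k integrations from 0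
   costs a Cauchy estimate, which shrinks the radius by eta. *)
Lemma flat_bound k : forall (phi : nat -> C^o -> C^o) (S M eta : R), 0 < eta ->
  (forall j s, rnorm s < S -> has_cderiv (phi j) s (phi j.+1 s)) ->
  (forall j, phi j 0 = 0) ->
  (forall s, rnorm s < S -> rnorm (phi 0%N s) <= M) ->
  forall s, rnorm s < S - k%:R * eta ->
  rnorm (phi 0%N s) <= M * (8 / eta) ^+ k * rnorm s ^+ k / k`!%:R.
Proof.
elim: k => [|k IH] phi S M eta eta0 phid phi0 phiM s.
  by rewrite mul0r subr0 !expr0 fact0 divr1 !mulr1; exact: phiM.
move=> sS.
have k1 : k.+1%:R * eta = k%:R * eta + eta by rewrite -natr1 mulrDl mul1r.
have ke0 : 0 <= k%:R * eta by rewrite mulr_ge0// ltW.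
have bd (x : C^o) : rnorm x < S - eta -> rnorm (phi 1%N x) <= 8 * M / eta.
  move=> xS; have in1 (y : C^o) : rnorm (y - x) < eta -> rnorm y < S.
    move=> yx; rewrite -(subrK x y) (le_lt_trans (ler_rnormD _ _))//.
    by move: (ltrD yx xS); rewrite subrKC.
  have xd : has_cderiv (phi 0%N) x (phi 1%N x).
    by apply: phid; apply: in1; rewrite subrr rnorm0.
  have [_ <-] := has_cderiv_diff xd.
  have hx : holo_ball (phi 0%N) x eta.
    by move=> y /in1 yS; exact: cderiv_differentiable (phid 0%N y yS).
  have := Cauchy_estimate (1 : C^o) eta0 hx (fun y yx => phiM y (in1 y yx)).
  have -> : rnorm (1 : C^o) = 1 := rnorm1 R.
  by rewrite mulr1.
have := @complex_mean_value R (fun t => phi 0%N (t * s)) k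
  (M * (8 / eta) ^+ k.+1 * rnorm s ^+ k.+1 / k`!%:R) (fun t => phi 1%N (t * s) * s).
rewrite mul1r mul0r phi0 subr0 factS natrM invfM [_ / k`!%:R / _]mulrAC mulrA; apply.
- move=> t /andP[t0 t1].
  have ts : rnorm (t%:C * s) <= rnorm s.
    by rewrite rnormM rnormC ger0_norm// ler_piMl// rnorm_ge0.
  have tsS : rnorm (t%:C * s) < S.
    by rewrite (le_lt_trans ts)// (lt_le_trans sS)// gerBl k1 addr_ge0// ltW.
  have zE (x : C) : 0 + x *: (s : C^o) = x * s by rewrite add0r.
  have [d1 d2] := has_cderiv_diff (phid 0%N (t%:C * s) tsS).
  have := @has_cderiv_line R C^o (phi 0%N) 0 s t%:C.
  rewrite zE => /(_ d1); rewrite linear_scale1 d2 -[_ *: _]/(s * phi 1%N (t%:C * s)) mulrC.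
  by have -> : (fun x : C => phi 0%N (0 + x *: (s : C^o))) = (fun x => phi 0%N (x * s))
    by apply/funext => x; rewrite zE.
move=> t /andP[t0 t1].
have ts : rnorm (t%:C * s) = t * rnorm s by rewrite rnormM rnormC ger0_norm.
have tsS : rnorm (t%:C * s) < S - eta - k%:R * eta.
  by rewrite ts -addrA -opprD [eta + _]addrC -k1 (le_lt_trans _ sS)// ler_piMl// rnorm_ge0.
have := IH (fun j => phi j.+1) (S - eta) (8 * M / eta) eta eta0 _ _ bd _ tsS.
have -> : M * (8 / eta) ^+ k.+1 * rnorm s ^+ k.+1 / k`!%:R * t ^+ k =
    8 * M / eta * (8 / eta) ^+ k * rnorm (t%:C * s) ^+ k / k`!%:R * rnorm s.
  by rewrite ts [(t * _) ^+ k]exprMn !exprS; ring.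
move=> H; rewrite (rnormM (phi 1%N _) s) ler_wpM2r ?rnorm_ge0//; apply: H => //.
by move=> j x xS; apply: phid; rewrite (lt_trans xS)// gtrBl.
Qed.

Lemma flat_eq0 (phi : nat -> C^o -> C^o) (S M : R) : 0 < S ->
  (forall j s, rnorm s < S -> has_cderiv (phi j) s (phi j.+1 s)) ->
  (forall j, phi j 0 = 0) ->
  (forall s, rnorm s < S -> rnorm (phi 0%N s) <= M) ->
  forall s, rnorm s * (32 * expR 1) <= S -> phi 0%N s = 0.
Proof.
move=> S0 phid phi0 phiM s sS.
have M0 : 0 <= M by rewrite (le_trans (rnorm_ge0 (phi 0%N 0)))// phiM// rnorm0.
(* flat_bound with eta of order S / k, and k ^ k / k! <= e ^ k. *)
have bk k : rnorm (phi 0%N s) <= M * (2^-1) ^+ k.+1.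
  have k0 : 0 < k.+1%:R :> R by rewrite ltr0n.
  pose eta := S / (2 * k.+1%:R).
  have eta0 : 0 < eta by rewrite divr_gt0// mulr_gt0.
  have e1 : 1 <= expR 1 :> R by rewrite (le_trans _ (expR_ge1Dx 1))// lerDl.
  have sS2 : rnorm s < S - k.+1%:R * eta.
    have -> : S - k.+1%:R * eta = S / 2 by rewrite /eta; field; rewrite gt_eqF.
    have := ler_wpM2l (rnorm_ge0 s) e1; move: sS S0 (rnorm_ge0 s); clear; lra.
  have := flat_bound eta0 phid phi0 phiM sS2 => /le_trans; apply.
  rewrite -!mulrA ler_wpM2l//.
  have kk : k.+1%:R ^+ k.+1 / k.+1`!%:R <= expR 1 ^+ k.+1 :> R.
    have h := @expR_ge1Dxn R k.+1%:R k (ler0n _ _).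
    by rewrite -expRM_natl mulr1; apply: le_trans h; rewrite lerDr.
  have -> : (8 / eta) ^+ k.+1 * (rnorm s ^+ k.+1 / k.+1`!%:R) =
    (16 * rnorm s / S) ^+ k.+1 * (k.+1%:R ^+ k.+1 / k.+1`!%:R).
    rewrite /eta [in RHS]mulrA [in LHS]mulrA -!exprMn; congr (_ ^+ _ / _).
    by field; rewrite !gt_eqF.
  have s0 : 0 <= 16 * rnorm s / S by rewrite divr_ge0 ?(ltW S0)// mulr_ge0 ?rnorm_ge0.
  apply: (@le_trans _ _ ((16 * rnorm s / S) ^+ k.+1 * expR 1 ^+ k.+1)).
    by rewrite ler_wpM2l ?exprn_ge0.
  rewrite -exprMn; apply: lerXn2r; rewrite ?nnegrE.
  - by apply: mulr_ge0 => //; exact: expR_ge0.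
  - by rewrite invr_ge0.
  by rewrite mulrAC ler_pdivrMr//; move: sS; clear; lra.
apply: rnorm_small0 => e e0.
pose n := Num.bound (M / e); apply: (le_trans (bk n)).
rewrite exprVn ler_pdivrMr ?exprn_gt0// mulrC -ler_pdivrMr//.
apply: (le_trans (ltW (archi_boundP _))); first by rewrite divr_ge0// ltW.
by rewrite -natrX ler_nat (leq_trans (ltnW (ltn_expl _ _)) (leq_pexp2l _ _)).
Qed.

Variable V : normedModType C.

Lemma holo_flat_eq0 (f : V -> C^o) p q (S M : R) : 0 < S -> holo_ball f p S ->
  (forall x, rnorm (x - p) < S -> rnorm (f x) <= M) ->
  (forall j h, iter j (fun (g : V -> C^o) x => 'd g x h : C^o) f p = 0) ->
  rnorm (q - p) * (32 * expR 1) <= S -> f q = 0.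
Proof.
move=> S0 fp fM flat qS; set h := q - p in qS.
have [h0|h0] := eqVneq h 0.
  by have := flat 0%N 0; rewrite /= -(subrK p q) -/h h0 add0r.
have hn : 0 < rnorm h.
  by rewrite lt_neqAle rnorm_ge0 andbT eq_sym; apply: contra_neq h0; exact: rnorm_eq0.
pose phi j (s : C^o) : C^o := iter j (fun (g : V -> C^o) x => 'd g x h : C^o) f (p + s *: h).
have inS (s : C^o) : rnorm s < S / rnorm h -> rnorm (p + s *: h - p) < S.
  by move=> sS; rewrite addrAC subrr add0r rnormZ -ltr_pdivlMr.
have -> : q = p + (1 : C) *: h by rewrite scale1r subrKC.
apply: (@flat_eq0 phi (S / rnorm h) M).
- by rewrite divr_gt0.
- move=> j s sS; apply: has_cderiv_line.
  have hj : holo_ball (iter j (fun (g : V -> C^o) x => 'd g x h : C^o) f) p S.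
    by elim: j => [//|j ih]; exact: holo_ball_diff ih.
  exact: hj (inS s sS).
- by move=> j; rewrite /phi scale0r addr0 flat.
- by move=> s sS; apply: fM; exact: inS.
by rewrite rnorm1 mul1r ler_pdivlMr// mulrC.
Qed.

End Flat.

(** * Real-analytic maps and tangent frames *)

Section MatrixNorm.
Context {K : numDomainType} {m n : nat}.
Implicit Type x : 'M[K]_(m, n).

Lemma entry_le_mx_norm x i j : `|x i j| <= `|x|.
Proof.
have : (`|x i j|%:nng <= \big[Num.max/0%:nng]_ij `|x ij.1 ij.2|%:nng)%R.
  by apply/bigmax_geP; right; exists (i, j).
by rewrite -num_le.
Qed.

Lemma mx_norm_le x e : 0 <= e -> (forall i j, `|x i j| <= e) -> `|x| <= e.
Proof.
move=> e0 xe; rewrite [leLHS]/(`| _ |) /=.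
have [->//|/mx_norm_neq0[[i j] ->]] := eqVneq (mx_norm x) 0.
exact: xe.
Qed.

End MatrixNorm.

Lemma lipschitz_linear_continuous (R : realType) (V W : normedModType R)
  (L : {linear V -> W}) (k : R) : (forall h, `|L h| <= k * `|h|) -> continuous L.
Proof.
move=> Lk z; apply/cvgrPdist_lt => e e0; apply/nbhs_ballP.
have k1 : 0 < `|k| + 1 by rewrite ltr_wpDl.
exists (e / (`|k| + 1)); first by rewrite /= divr_gt0.
move=> y; rewrite -ball_normE => zy; rewrite -linearB (le_lt_trans (Lk _))//.
rewrite (@le_lt_trans _ _ ((`|k| + 1) * `|z - y|))//.
  by rewrite ler_wpM2r// (le_trans (ler_norm k))// lerDl.
by rewrite mulrC -ltr_pdivlMr//; exact: zy.
Qed.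

Section RealAnalytic.
Variables (R : realType) (m : nat).
Implicit Types (c : {ffun 'I_m -> nat} -> R) (h x : 'rV[R]_m).

Let deg N (a : {ffun 'I_m -> 'I_N}) : nat := \sum_i a i.

Let unit_exp N (j : 'I_m) : {ffun 'I_m -> 'I_N.+2} :=
  [ffun i => if i == j then lift ord0 ord0 else ord0].

Definition linear_part c h : R :=
  \sum_j c [ffun i => (i == j) : nat] * h 0 j.

Lemma linear_part_linear c : linear (linear_part c).
Proof.
move=> k u v; rewrite /linear_part scaler_sumr -big_split /=; apply: eq_bigr => j _.
by rewrite !mxE mulrDr; congr (_ + _); exact: mulrCA.
Qed.

Lemma box_sum_affine c h N : exists2 A : pred {ffun 'I_m -> 'I_N.+2},
  box_sum c h N.+2 = c [ffun=> 0%N] + linear_part c h +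
    \sum_(a | A a) c [ffun i => nat_of_ord (a i)] * \prod_i h 0 i ^+ a i
  & forall a, A a -> (1 < deg a)%N.
Proof.
pose E := @unit_exp N.
pose G (a : {ffun 'I_m -> 'I_N.+2}) :=
  c [ffun i => nat_of_ord (a i)] * \prod_i h 0 i ^+ a i.
pose E0 : {ffun 'I_m -> 'I_N.+2} := [ffun=> ord0].
have Einj : injective E.
  move=> i j /ffunP/(_ i); rewrite !ffunE eqxx.
  by case: eqP => // _ /(congr1 val).
have EN0 j : E j != E0.
  by apply/eqP => /ffunP/(_ j); rewrite !ffunE eqxx => /(congr1 val).
exists (fun a => (a != E0) && (a \notin E @: [set: 'I_m]%SET)).
  rewrite /box_sum (bigD1 E0)//= -addrA; congr (_ + _).
    rewrite big1 ?mulr1; last by move=> i _; rewrite ffunE expr0.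
    by congr c; apply/ffunP => i; rewrite !ffunE.
  rewrite (bigID (mem (E @: [set: 'I_m]%SET))) /=; congr (_ + _).
  transitivity (\sum_(a in E @: [set: 'I_m]%SET) G a).
    apply: eq_bigl => a; apply: andb_idl => /imsetP[j _ ->]; exact: EN0.
  rewrite big_imset; last by move=> ? ? _ _; exact: Einj.
  rewrite /linear_part; apply: eq_big => [j|j _]; first by rewrite inE.
  rewrite /G; congr (_ * _).
    by congr c; apply/ffunP => i; rewrite !ffunE; case: eqP.
  rewrite (bigD1 j)//= ffunE eqxx expr1 big1 ?mulr1// => i /negPf ij.
  by rewrite ffunE ij expr0.
move=> a /andP[aN0 aNE]; rewrite ltnNge; apply/negP => d1.
have [i ai] : exists i, a i != ord0 :> 'I_N.+2.
  apply/existsP; apply: contraNT aN0 => /existsPn a0; apply/eqP/ffunP => i.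
  by rewrite ffunE; apply/eqP; rewrite -[_ == _]negbK a0.
have ai1 : (0 < a i)%N by rewrite lt0n.
move: d1; rewrite /deg (bigD1 i)//= => d1.
have aiE : a i = 1%N :> nat.
  by apply/eqP; rewrite eqn_leq ai1 andbT (leq_trans _ d1)// leq_addr.
move: d1; rewrite aiE -[leqRHS]addn0 leq_add2l leqn0 sum_nat_eq0 => /forall_inP aj.
case/negP: aNE; apply/imsetP; exists i; rewrite ?inE//.
apply/ffunP => j; rewrite ffunE; apply/val_inj => /=.
by have [->|ji] := eqVneq j i; [rewrite aiE|apply/eqP; rewrite aj].
Qed.

Lemma real_analytic_differentiable (f : 'rV[R]_m -> R) x :
  real_analytic_at f x -> differentiable f x.
Proof.
move=> [c [r [r0 hf]]]; pose rho := r / 2.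
have rho0 : 0 < rho by rewrite divr_gt0.
have rhor : rho < r by rewrite ltr_pdivrMr// ltr_pMr// ltr1n.
have inball h : `|h| <= rho -> ball x r (x + h).
  by move=> hr; rewrite -ball_normE /= opprD addNKr normrN (le_lt_trans hr).
have cn : `|const_mx rho : 'rV[R]_m| <= rho.
  by apply: mx_norm_le => [|i j]; rewrite ?mxE ?gtr0_norm// ltW.
have [/cvg_seq_bounded[B [_ hB]] _] := hf _ (inball _ cn).
pose B' := `|B| + 1; have B'0 : 0 < B' by rewrite ltr_wpDl.
have BB N : box_sum (fun a => `|c a|) (const_mx rho) N <= B'.
  have := hB B' _ N I.
  rewrite (_ : x + const_mx rho - x = const_mx rho); last by rewrite addrAC subrr add0r.
  have -> : map_mx Num.norm (const_mx rho) = const_mx rho :> 'rV[R]_m.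
    by apply/matrixP => i j; rewrite !mxE gtr0_norm.
  move=> H; apply: (le_trans (ler_norm _)); apply: H.
  by rewrite (le_lt_trans (ler_norm B))// ltrDl.
have est h : `|h| <= rho ->
    `|f (x + h) - (c [ffun=> 0%N] + linear_part c h)| <= (`|h| / rho) ^+ 2 * B'.
  move=> hr; have [_ fh] := hf _ (inball _ hr).
  move: fh; rewrite (_ : x + h - x = h); last by rewrite addrAC subrr add0r.
  move=> fh; apply: (cvgr_to_le (cvg_norm (cvgB fh (cvg_cst _)))).
  exists 2%N => // -[|[|N]]// _ /=.
  rewrite -[X in `|X|]/(box_sum c h N.+2 - (c [ffun=> 0%N] + linear_part c h)).
  have [A -> degA] := box_sum_affine c h N.
  rewrite [X in `|X|]addrC addKr.
  apply: (le_trans (ler_norm_sum _ _ _)).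
  apply: (@le_trans _ _ (\sum_(a | A a) (`|h| / rho) ^+ 2 *
      (`|c [ffun i => nat_of_ord (a i)]| * \prod_i (const_mx rho : 'rV[R]_m) 0 i ^+ a i))).
    apply: ler_sum => a /degA d2; rewrite normrM mulrCA ler_wpM2l//.
    rewrite normr_prod.
    have -> : \prod_i (const_mx rho : 'rV[R]_m) 0 i ^+ a i = \prod_i rho ^+ a i.
      by apply: eq_bigr => i _; rewrite mxE.
    apply: (@le_trans _ _ (\prod_i `|h| ^+ a i)).
      by apply: ler_prod => i _; rewrite normr_ge0 normrX lerXn2r ?nnegrE ?entry_le_mx_norm.
    rewrite -!expr_sum -/(deg a) -(subnKC d2) !exprD exprMn exprVn.
    rewrite [leRHS]mulrA divfK; last by rewrite expf_neq0 ?gt_eqF.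
    by rewrite ler_wpM2l ?exprn_ge0// lerXn2r ?nnegrE// ltW.
  rewrite -mulr_sumr ler_wpM2l ?sqr_ge0//; apply: le_trans (BB N.+2).
  rewrite /box_sum [leRHS](bigID A)/= lerDl; apply: sumr_ge0 => a _.
  by apply: mulr_ge0 => //; apply: prodr_ge0 => i _; rewrite mxE exprn_ge0// ltW.
have fx : f x = c [ffun=> 0%N].
  have := est 0; rewrite normr0 addr0 mul0r expr0n /= mul0r => /(_ (ltW rho0)).
  rewrite normr_le0 subr_eq0 => /eqP ->.
  by rewrite /linear_part big1 ?addr0// => j _; rewrite mxE mulr0.
pose L : {linear 'rV[R]_m -> R} := HB.pack (linear_part c)
  (GRing.isLinear.Build R 'rV[R]_m R _ _ (linear_part_linear c)).
pose k := \sum_j `|c [ffun i => (i == j) : nat]|.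
have k0 : 0 <= k by apply: sumr_ge0.
have Lk h : `|L h| <= k * `|h|.
  rewrite -[L h]/(linear_part c h) /linear_part (le_trans (ler_norm_sum _ _ _))//.
  by rewrite mulr_suml; apply: ler_sum => j _; rewrite normrM ler_wpM2l ?entry_le_mx_norm.
have Lc := lipschitz_linear_continuous Lk.
suff : is_diff x f L by case.
apply: near_is_diff => // e e0; apply/nbhs_ballP.
pose d := Num.min rho (e * rho ^+ 2 / B').
have d0 : 0 < d by rewrite lt_min rho0 !divr_gt0// mulr_gt0// exprn_gt0.
exists d => // h; rewrite -ball_normE /= sub0r normrN lt_min => /andP[h1 h2].
have := est h (ltW h1); rewrite opprD addrA -fx => /le_trans; apply.
have -> : (`|h| / rho) ^+ 2 * B' = (`|h| * B' / rho ^+ 2) * `|h|.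
  by field; rewrite gt_eqF.
rewrite ler_wpM2r// ler_pdivrMr ?exprn_gt0// -ler_pdivlMr//.
exact: ltW.
Qed.

End RealAnalytic.

Section RowDifferentiable.
Variables (R : realType) (m n : nat).

Lemma row_differentiable (G : 'rV[R]_m -> 'rV[R]_n) t :
  (forall k, differentiable (fun s => G s 0 k) t) -> differentiable G t.
Proof.
move=> Gd; pose Lf h : 'rV[R]_n := \row_k 'd (fun s => G s 0 k) t h.
have Llin : linear Lf.
  by move=> a u v; apply/rowP => k; rewrite !mxE linearP.
pose L : {linear 'rV[R]_m -> 'rV[R]_n} := HB.pack Lf
  (GRing.isLinear.Build R 'rV[R]_m 'rV[R]_n _ _ Llin).
have Lb k : exists K, forall h, `|'d (fun s => G s 0 k) t h| <= K * `|h|.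
  by have [K _ hK] := linear_lipschitz (diff_continuous (Gd k)); exists K.
have /boolp.choice[K hK] := Lb.
have Lc : continuous L.
  apply: (@lipschitz_linear_continuous R _ _ L (\sum_k `|K k|)) => h.
  apply: mx_norm_le => [|i j]; first by rewrite mulr_ge0// sumr_ge0.
  rewrite ord1 mxE (le_trans (hK j h))// ler_wpM2r// (le_trans (ler_norm _))//.
  by rewrite (bigD1 j)//= lerDl sumr_ge0.
suff : is_diff t G L by case.
apply: near_is_diff => // e e0.
near=> h; apply: mx_norm_le => [|i j]; first by rewrite mulr_ge0// ltW.
rewrite ord1 !mxE; move: j; near: h; apply: filter_forall => k /=.
exact: differentiable_near (Gd k) e e0.
Unshelve. all: by end_near. Qed.

End RowDifferentiable.

Section Tangent.
Variables (R : realType) (m : nat).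
Local Notation C := R[i].
Local Notation cmx := (map_mx (real_complex R)).
Local Notation V := ('rV[C]_m : normedModType C).
Implicit Types (F : 'rV[R]_m -> 'rV[C]_m) (A : 'M[C]_m).

Definition has_tangent F t A := forall (a : 'rV[R]_m) (e : R), 0 < e ->
  exists2 d, 0 < d & forall s, `|s| < d ->
    rnorm (F (t + s *: a) - F t - s%:C *: (cmx a *m A)) <= e * `|s|.

Lemma real_mul_complex_mx (a : 'rV[R]_m) (J1 J2 : 'M[R]_m) :
  cmx a *m (cmx J1 + 'i *: cmx J2) = cmx (a *m J1) + 'i *: cmx (a *m J2).
Proof. by rewrite mulmxDr -scalemxAr -!map_mxM. Qed.

Lemma Re_entry (x y : 'rV[C]_m) (a1 a2 : 'rV[R]_m) (s : R) j :
  complex.Re ((x - y - s%:C *: (cmx a1 + 'i *: cmx a2)) 0 j) =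
  (map_mx (@complex.Re R) x - map_mx (@complex.Re R) y - s *: a1) 0 j.
Proof.
rewrite !mxE; move: (x 0 j) (y 0 j) (a1 0 j) (a2 0 j) => [x1 x2] [y1 y2] b1 b2.
by rewrite /=; ring.
Qed.

Lemma Im_entry (x y : 'rV[C]_m) (a1 a2 : 'rV[R]_m) (s : R) j :
  complex.Im ((x - y - s%:C *: (cmx a1 + 'i *: cmx a2)) 0 j) =
  (map_mx (@complex.Im R) x - map_mx (@complex.Im R) y - s *: a2) 0 j.
Proof.
rewrite !mxE; move: (x 0 j) (y 0 j) (a1 0 j) (a2 0 j) => [x1 x2] [y1 y2] b1 b2.
by rewrite /=; ring.
Qed.

Lemma rnorm_row_le (x : 'rV[C]_m) e : 0 <= e -> (forall j, rnorm (x 0 j) <= e) ->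
  rnorm x <= e.
Proof.
move=> e0 xe; rewrite -(@lecR R) -rnormE; apply: mx_norm_le; first by rewrite ler0c.
by move=> i j; rewrite ord1 rnormE lecR.
Qed.

Lemma differentiable_has_tangent F t :
  (forall k, real_analytic_at (fun s => complex.Re (F s 0 k)) t) ->
  (forall k, real_analytic_at (fun s => complex.Im (F s 0 k)) t) ->
  has_tangent F t (cmx (jacobian (fun s => map_mx (@complex.Re R) (F s)) t)
    + 'i *: cmx (jacobian (fun s => map_mx (@complex.Im R) (F s)) t)).
Proof.
set F1 := fun s => map_mx (@complex.Re R) (F s); set F2 := fun s => map_mx (@complex.Im R) (F s).
move=> an1 an2 a e e0.
have d1 : differentiable F1 t.
  apply: row_differentiable => k; have := real_analytic_differentiable (an1 k).
  have -> // : (fun s => F1 s 0 k) = (fun s => complex.Re (F s 0 k)).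
  by apply/funext => s; rewrite mxE.
have d2 : differentiable F2 t.
  apply: row_differentiable => k; have := real_analytic_differentiable (an2 k).
  have -> // : (fun s => F2 s 0 k) = (fun s => complex.Im (F s 0 k)).
  by apply/funext => s; rewrite mxE.
have a0 : 0 < `|a| + 1 by rewrite ltr_wpDl.
pose e' := e / 2 / (`|a| + 1).
have e'0 : 0 < e' by rewrite !divr_gt0.
have [r1 /= r10 h1] := (nbhs_ballP _ _).1 (differentiable_near d1 e'0).
have [r2 /= r20 h2] := (nbhs_ballP _ _).1 (differentiable_near d2 e'0).
exists (Num.min r1 r2 / (`|a| + 1)); first by rewrite divr_gt0// lt_min r10.
move=> s; rewrite ltr_pdivlMr// lt_min => /andP[s1 s2].
have sa : `|s *: a| <= `|s| * (`|a| + 1) by rewrite normrZ ler_wpM2l// lerDl.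
have {h1} h1 : `|F1 (t + s *: a) - F1 t - 'd F1 t (s *: a)| <= e / 2 * `|s|.
  apply: (le_trans (h1 (s *: a) _)).
    by rewrite -ball_normE /= sub0r normrN (le_lt_trans sa).
  have <- : e' * (`|s| * (`|a| + 1)) = e / 2 * `|s| by rewrite /e'; field; rewrite gt_eqF.
  by rewrite ler_wpM2l// ltW.
have {h2} h2 : `|F2 (t + s *: a) - F2 t - 'd F2 t (s *: a)| <= e / 2 * `|s|.
  apply: (le_trans (h2 (s *: a) _)).
    by rewrite -ball_normE /= sub0r normrN (le_lt_trans sa).
  have <- : e' * (`|s| * (`|a| + 1)) = e / 2 * `|s| by rewrite /e'; field; rewrite gt_eqF.
  by rewrite ler_wpM2l// ltW.
apply: rnorm_row_le => [|j]; first by rewrite mulr_ge0// ltW.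
have -> : e * `|s| = e / 2 * `|s| + e / 2 * `|s| by field.
apply: (le_trans (ler_rnormReIm _)).
set J1 := jacobian F1 t; set J2 := jacobian F2 t.
have dJ (G : 'rV[R]_m -> 'rV[R]_m) : 'd G t (s *: a) = s *: (a *m jacobian G t).
  by rewrite scalemxAl /jacobian mul_rV_lin1.
rewrite (dJ F1) -/J1 in h1; rewrite (dJ F2) -/J2 in h2.
rewrite real_mul_complex_mx.
rewrite Re_entry Im_entry.
apply: lerD; [apply: le_trans h1|apply: le_trans h2]; exact: entry_le_mx_norm.
Qed.

Lemma tangent_comp F (t : 'rV[R]_m) A (f : 'rV[C]_m -> C^o) (a : 'rV[R]_m) :
  has_tangent F t A -> differentiable f (F t : V) -> forall e, 0 < e -> exists2 d, 0 < d &
  forall s, `|s| < d ->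
    rnorm (f (F (t + s *: a)) - f (F t) - s%:C * 'd f (F t : V) (cmx a *m A) : C)
      <= e * `|s|.
Proof.
move=> Ft fd e e0; set w := cmx a *m A.
have [k k0 hk] := diff_bounded fd.
have w0 : 0 < rnorm w + 1 by rewrite ltr_wpDl ?rnorm_ge0.
have [r r0 hr] := differentiable_rnorm fd (divr_gt0 (divr_gt0 e0 (ltr0n R 2)) w0).
have e1 : 0 < Num.min 1 (e / 2 / k) by rewrite lt_min ltr01 !divr_gt0.
have [d d0 hd] := Ft a _ e1.
exists (Num.min d (r / (rnorm w + 1))); first by rewrite lt_min d0 divr_gt0.
move=> s; rewrite lt_min ltr_pdivlMr// => /andP[/hd sd sr].
set h := F (t + s *: a) - F t in sd *.
have sd1 : rnorm (h - s%:C *: w) <= `|s|.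
  by rewrite (le_trans sd)// ler_piMl// ge_min lexx.
have sd2 : rnorm (h - s%:C *: w) <= e / 2 / k * `|s|.
  by rewrite (le_trans sd)// ler_wpM2r// ge_min lexx orbT.
have hs : rnorm h <= `|s| * (rnorm w + 1).
  rewrite -(subrK (s%:C *: w) h) (le_trans (ler_rnormD _ _))// addrC mulrDr mulr1.
  by rewrite lerD// rnormZ rnormC.
have := hr h (le_lt_trans hs sr); rewrite {1}/h subrKC => H.
have -> : s%:C * 'd f (F t : V) w = 'd f (F t : V) (s%:C *: w) by symmetry; exact: linearZ.
have -> : f (F (t + s *: a)) - f (F t) - 'd f (F t : V) (s%:C *: w) =
   (f (F (t + s *: a)) - f (F t) - 'd f (F t : V) h) + 'd f (F t : V) (h - s%:C *: w).
  have -> : 'd f (F t : V) (h - s%:C *: w) = 'd f (F t : V) h - 'd f (F t : V) (s%:C *: w).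
    exact: linearB.
  by rewrite addrA subrK.
apply: (le_trans (ler_rnormD _ _)).
have -> : e * `|s| = e / 2 * `|s| + e / 2 * `|s| by field.
apply: lerD.
  apply: (le_trans H); apply: (le_trans (ler_wpM2l _ hs)); first by rewrite !divr_ge0// ltW.
  by rewrite mulrCA divfK ?gt_eqF// mulrC.
apply: (le_trans (hk _)); apply: (le_trans (ler_wpM2l (ltW k0) sd2)).
by rewrite mulrA [k * _]mulrC divfK ?gt_eqF.
Qed.

Definition frame_at F (t : 'rV[R]_m) := exists2 A, A \in unitmx & has_tangent F t A.

Lemma diff_eq0_frame F (t : 'rV[R]_m) (f : 'rV[C]_m -> C^o) : frame_at F t ->
  differentiable f (F t : V) -> (\forall s \near t, f (F s) = 0) ->
  forall h, 'd f (F t : V) h = 0.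
Proof.
move=> [A Au FA] fd f0 h.
have f0t : f (F t) = 0 by exact: nbhs_singleton f0.
have [r /= r0 hr] := (nbhs_ballP _ _).1 f0.
have real a : 'd f (F t : V) (cmx a *m A) = 0.
  apply: rnorm_small0 => e e0; have [d d0 hd] := tangent_comp a FA fd e0.
  have a0 : 0 < `|a| + 1 by rewrite ltr_wpDl.
  pose s := Num.min d (r / (`|a| + 1)) / 2.
  have m0 : 0 < Num.min d (r / (`|a| + 1)) by rewrite lt_min d0 divr_gt0.
  have s0 : 0 < s by rewrite divr_gt0.
  have sm : s < Num.min d (r / (`|a| + 1)) by rewrite ltr_pdivrMr// ltr_pMr// ltr1n.
  have := sm; rewrite lt_min ltr_pdivlMr// => /andP[sd sr].
  have := hd s; rewrite gtr0_norm// => /(_ sd); rewrite hr; last first.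
    rewrite -ball_normE /= opprD addNKr normrN normrZ gtr0_norm// (le_lt_trans _ sr)//.
    by rewrite ler_pM2l// lerDl.
  rewrite f0t subrr sub0r rnormN rnormM rnormC gtr0_norm// mulrC ler_pM2r//.
have -> : h = h *m invmx A *m A by rewrite mulmxKV.
set g := h *m invmx A.
have -> : g = cmx (map_mx (@complex.Re R) g) + 'i *: cmx (map_mx (@complex.Im R) g).
  by apply/matrixP => i j; rewrite !mxE -complexE.
rewrite mulmxDl -scalemxAl.
have E a b : 'd f (F t : V) (a + 'i *: b) = 'd f (F t : V) a + 'i * 'd f (F t : V) b.
  rewrite [LHS]linearD; congr (_ + _); exact: linearZ.
by rewrite E !real mulr0 addr0.
Qed.

Lemma holo_flat_on_frame F (t : 'rV[R]_m) (f : 'rV[C]_m -> C^o) (S : R) :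
  0 < S -> holo_ball (f : V -> C^o) (F t) S ->
  (\forall s \near t, frame_at F s) ->
  (\forall s \near t, rnorm (F s - F t) < S) ->
  (\forall s \near t, f (F s) = 0) ->
  forall j h, iter j (fun (g : V -> C^o) x => 'd g x h : C^o) f (F t) = 0.
Proof.
move=> S0 fp Ff FS f0 j h.
suff : holo_ball (iter j (fun (g : V -> C^o) x => 'd g x h : C^o) f) (F t) S /\
  (\forall s \near t, iter j (fun (g : V -> C^o) x => 'd g x h : C^o) f (F s) = 0).
  by move=> [_ /nbhs_singleton].
elim: j => [//|j [ih1 ih2]]; split; first exact: holo_ball_diff ih1.
have : \forall s \near t, [/\ frame_at F s, rnorm (F s - F t) < S &
   \forall s' \near s, iter j (fun (g : V -> C^o) x => 'd g x h : C^o) f (F s') = 0].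
  have ih3 := near_join ih2.
  by near=> s; split; near: s.
apply: filterS => s [fs sS s0].
exact: (diff_eq0_frame fs (ih1 _ sS) s0).
Unshelve. all: by end_near. Qed.

Lemma tangent_derive F (t : 'rV[R]_m) A (f : 'rV[C]_m -> C^o) (u : 'rV[R]_m -> R)
    (a : 'rV[R]_m) :
  has_tangent F t A -> differentiable f (F t : V) ->
  (\forall s \near t, f (F s) = (u s)%:C) ->
  ('D_a u t)%:C = 'd f (F t : V) (cmx a *m A).
Proof.
move=> FA fd fu; set D := 'd f (F t : V) (cmx a *m A).
have [r /= r0 hr] := (nbhs_ballP _ _).1 fu.
have a0 : 0 < `|a| + 1 by rewrite ltr_wpDl.
have est e : 0 < e -> exists2 d, 0 < d & forall s : R, `|s| < d ->
    rnorm ((u (t + s *: a) - u t)%:C - s%:C * D) <= e * `|s|.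
  move=> e0; have [d d0 hd] := tangent_comp a FA fd e0.
  exists (Num.min d (r / (`|a| + 1))); first by rewrite lt_min d0 divr_gt0.
  move=> s; rewrite lt_min ltr_pdivlMr// => /andP[/hd sd sr].
  rewrite rmorphB /= -!hr//; first by rewrite -ball_normE /= subrr normr0.
  rewrite -ball_normE /= opprD addNKr normrN normrZ (le_lt_trans _ sr)//.
  by rewrite ler_wpM2l// lerDl.
have -> : 'D_a u t = complex.Re D.
  apply/cvg_lim => //; apply/cvgrPdist_le => e e0.
  have [d d0 hd] := est e e0; exists d => // s; rewrite /= sub0r normrN => sd s0.
  have := hd s sd => H.
  have : `|(u (t + s *: a) - u t) - s * complex.Re D| <= e * `|s|.
    apply: le_trans H; apply: le_trans (ler_Re _).
    by move: (D) => [D1 D2]; rewrite /= mul0r subr0.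
  have -> : complex.Re D - s^-1 *: (u (s *: a + t) - u t) =
     - (s^-1 * ((u (t + s *: a) - u t) - s * complex.Re D)).
    by rewrite [s *: a + t]addrC -[s^-1 *: _]/(s^-1 * _); field.
  by move=> H2; rewrite normrN normrM normfV ler_pdivrMl ?normr_gt0// [leRHS]mulrC.
have imD : complex.Im D = 0.
  apply/eqP; rewrite -normr_le0; apply/ler_addgt0Pr => e e0; rewrite add0r.
  have [d d0 hd] := est e e0; have d2 : 0 < d / 2 by rewrite divr_gt0.
  have := hd (d / 2); rewrite gtr0_norm// ltr_pdivrMr// ltr_pMr// ltr1n => /(_ isT) H.
  have : `|complex.Im ((u (t + (d / 2) *: a) - u t)%:C - (d / 2)%:C * D)| <= e * (d / 2).
    by apply: le_trans H; exact: ler_Im.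
  case: D {est hd H} => D1 D2; rewrite /= mul0r addr0 sub0r normrN normrM gtr0_norm//.
  by rewrite mulrC ler_pM2r.
by move: (D) imD => [D1 D2] /= ->.
Qed.

End Tangent.

(** * Brackets and gradients *)

Section PoissonAlgebra.
Variables (K : fieldType) (m : nat).
Implicit Types (W J : 'M[K]_m) (a b : 'rV[K]_m).

Lemma unit_congr W1 W2 J : W1 = J *m W2 *m J^T -> W1 \in unitmx -> J \in unitmx.
Proof. by move=> ->; rewrite !unitmx_mul => /andP[/andP[]]. Qed.

End PoissonAlgebra.

Section Poisson.
Variables (K : numFieldType) (m : nat).
Implicit Types (W J : 'M[K]_m) (a b : 'rV[K]_m).

Lemma poissonE W a b : W \in unitmx ->
  poisson W a b = (a *m (b *m invmx W)^T) 0 0.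
Proof. by move=> Wu; rewrite /poisson /hamiltonian mulmxKV. Qed.

(* The adjugate makes the vanishing of the bracket a polynomial condition. *)
Lemma poisson_adj W a b : W \in unitmx ->
  (poisson W a b == 0) = ((a *m (b *m \adj W)^T) 0 0 == 0).
Proof.
move=> Wu; rewrite poissonE// /invmx Wu -scalemxAr linearZ /= -scalemxAr mxE.
rewrite mulf_eq0 invr_eq0; case: eqP Wu => // W0; by rewrite unitmxE unitfE W0 eqxx.
Qed.

Lemma poisson_congr W1 W2 J a b : W1 \in unitmx -> W2 \in unitmx ->
  W1 = J *m W2 *m J^T -> poisson W1 (a *m J^T) (b *m J^T) = poisson W2 a b.
Proof.
move=> W1u W2u WE; have Ju := unit_congr WE W1u.
rewrite !poissonE//; set y := b *m J^T *m invmx W1.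
have yE : y *m J = b *m invmx W2.
  apply: (can_inj (mulmxK W2u)); rewrite mulmxKV//.
  have JTu : J^T \in unitmx by rewrite unitmx_tr.
  apply: (can_inj (mulmxK JTu)).
  by rewrite -[RHS](mulmxKV W1u) -/y WE !mulmxA.
by rewrite -yE (trmx_mul y J) mulmxA.
Qed.

End Poisson.

Section DifferentiableMatrix.
Variables (K : numFieldType) (V : normedModType K) (z : V).

Lemma differentiable_bigsum I (r : seq I) (P : pred I) (F : I -> V -> K^o) :
  (forall i, differentiable (F i) z) ->
  differentiable (fun x => \sum_(i <- r | P i) F i x : K^o) z.
Proof.
move=> Fd; elim: r => [|i r ih].
  have -> : (fun x => \sum_(i <- [::] | P i) F i x : K^o) = cst 0.
    by apply/funext => x; rewrite big_nil.
  exact: differentiable_cst.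
have -> : (fun x => \sum_(j <- i :: r | P j) F j x : K^o) =
    if P i then F i + (fun x => \sum_(j <- r | P j) F j x)
    else (fun x => \sum_(j <- r | P j) F j x).
  by apply/funext => x; rewrite big_cons; case: (P i).
by case: (P i); [exact: differentiableD|exact: ih].
Qed.

Lemma differentiable_bigprod I (r : seq I) (P : pred I) (F : I -> V -> K^o) :
  (forall i, differentiable (F i) z) ->
  differentiable (fun x => \prod_(i <- r | P i) F i x : K^o) z.
Proof.
move=> Fd; elim: r => [|i r ih].
  have -> : (fun x => \prod_(i <- [::] | P i) F i x : K^o) = cst 1.
    by apply/funext => x; rewrite big_nil.
  exact: differentiable_cst.
have -> : (fun x => \prod_(j <- i :: r | P j) F j x : K^o) =
    if P i then F i * (fun x => \prod_(j <- r | P j) F j x)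
    else (fun x => \prod_(j <- r | P j) F j x).
  by apply/funext => x; rewrite big_cons; case: (P i).
by case: (P i); [exact: differentiableM|exact: ih].
Qed.

Definition mx_differentiable m n (A : V -> 'M[K]_(m, n)) :=
  forall i j, differentiable (fun x => A x i j : K^o) z.

Lemma mx_differentiable_mul m n p (A : V -> 'M[K]_(m, n)) (B : V -> 'M[K]_(n, p)) :
  mx_differentiable A -> mx_differentiable B ->
  mx_differentiable (fun x => A x *m B x).
Proof.
move=> Ad Bd i j.
have -> : (fun x => (A x *m B x) i j : K^o) = (fun x => \sum_k (A x i k * B x k j) : K^o).
  by apply/funext => x; rewrite mxE.
apply: differentiable_bigsum => k.
exact: (differentiableM (Ad i k) (Bd k j)).
Qed.

Lemma differentiable_det m (A : V -> 'M[K]_m) : mx_differentiable A ->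
  differentiable (fun x => \det (A x) : K^o) z.
Proof.
move=> Ad; apply: differentiable_bigsum => s.
apply: (differentiableM (differentiable_cst _ _)).
by apply: differentiable_bigprod => i.
Qed.

Lemma mx_differentiable_adj m (A : V -> 'M[K]_m) : mx_differentiable A ->
  mx_differentiable (fun x => \adj (A x)).
Proof.
move=> Ad i j.
have -> : (fun x => (\adj (A x)) i j : K^o) =
    (fun x => (-1) ^+ (j + i) * \det (row' j (col' i (A x))) : K^o).
  by apply/funext => x; rewrite mxE.
apply: (differentiableM (differentiable_cst _ _)).
apply: differentiable_det => k l.
have -> : (fun x => row' j (col' i (A x)) k l : K^o) =
   (fun x => A x (lift j k) (lift i l) : K^o) by apply/funext => x; rewrite !mxE.
exact: Ad.
Qed.

Lemma mx_differentiable_tr m n (A : V -> 'M[K]_(m, n)) : mx_differentiable A ->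
  mx_differentiable (fun x => (A x)^T).
Proof.
move=> Ad i j.
have -> : (fun x => (A x)^T i j : K^o) = (fun x => A x j i : K^o).
  by apply/funext => x; rewrite mxE.
exact: Ad.
Qed.

End DifferentiableMatrix.

Section Gradient.
Variables (K : numFieldType) (m : nat).

Lemma diff_grad (f : 'rV[K]_m -> K) z w : differentiable f z ->
  'd f z w = (w *m (grad f z)^T) 0 0.
Proof.
move=> fd; rewrite [in LHS](row_sum_delta w) linear_sum mxE; apply: eq_bigr => j _.
by rewrite linearZ /= !mxE deriveE.
Qed.

Lemma grad_entry (f : 'rV[K]_m -> K) z j : differentiable f z ->
  grad f z 0 j = 'd f z (delta_mx 0 j).
Proof. by move=> fd; rewrite mxE deriveE. Qed.

Lemma near_grad (f g : 'rV[K]_m -> K) z : (\forall x \near z, f x = g x) ->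
  grad f z = grad g z.
Proof. by move=> fg; apply/rowP => j; rewrite !mxE; exact: near_eq_derive. Qed.

Lemma grad_comp (f : 'rV[K]_m -> K) (tau : 'rV[K]_m -> 'rV[K]_m) z :
  differentiable tau z -> differentiable f (tau z) ->
  grad (f \o tau) z = grad f (tau z) *m (jacobian tau z)^T.
Proof.
move=> td fd; apply/rowP => j; rewrite grad_entry; last exact: differentiable_comp.
have -> : 'd (f \o tau) z (delta_mx 0 j) = 'd f (tau z) ('d tau z (delta_mx 0 j)).
  by move: (diff_comp td fd) => /(congr1 (fun F : 'rV[K]_m -> K => F (delta_mx 0 j))).
rewrite (diff_grad _ fd).
have -> : 'd tau z (delta_mx 0 j) = delta_mx 0 j *m jacobian tau z.
  by rewrite /jacobian mul_rV_lin1.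
rewrite -rowE -[in RHS](trmxK (grad f (tau z) *m _)) trmx_mul trmxK.
by rewrite [in RHS]mxE !mxE; apply: eq_bigr => k _; rewrite !mxE.
Qed.

End Gradient.

(** * Analytic subsets of a complex manifold *)

Section Charts.
Variables (K : numFieldType) (m : nat) (T : topologicalType).

Lemma chart_dom_open (phi : chart K m [set: T]) : open (cdom phi).
Proof. by have [V oV ->] := cdom_open phi; rewrite setTI. Qed.

Lemma chart_continuous (phi : chart K m [set: T]) x : cdom phi x ->
  {for x, continuous (cfun phi)}.
Proof.
move=> px; have := @cfun_continuous _ _ _ _ phi.
rewrite continuous_open_subspace; last exact: chart_dom_open.
by apply; rewrite inE.
Qed.

Lemma chart_inv_continuous (S : set T) (g : chart K m S) z : ccod g z ->
  {for z, continuous (cinv g)}.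
Proof.
move=> gz; have := @cinv_continuous _ _ _ _ g.
rewrite continuous_open_subspace; last exact: ccod_open.
by apply; rewrite inE.
Qed.

Lemma chartK (S : set T) (g : chart K m S) x : cdom g x -> cinv g (cfun g x) = x.
Proof. by move=> gx; apply: cfunK; rewrite inE. Qed.

Lemma chart_invK (S : set T) (g : chart K m S) z : ccod g z -> cfun g (cinv g z) = z.
Proof. by move=> gz; apply: cinvK; rewrite inE. Qed.

Lemma chart_cod (S : set T) (g : chart K m S) x : cdom g x -> ccod g (cfun g x).
Proof. exact: cfun_cod. Qed.

Lemma chart_dom (S : set T) (g : chart K m S) z : ccod g z -> cdom g (cinv g z).
Proof. exact: cinv_dom. Qed.

Lemma chart_near (S : set T) (g : chart K m S) z (P : set T) : ccod g z ->
  nbhs (cinv g z) P -> \forall w \near z, ccod g w /\ P (cinv g w).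
Proof.
move=> gz Pz; have h1 : \forall w \near z, ccod g w.
  by apply: open_nbhs_nbhs; split => //; exact: ccod_open.
have h2 := chart_inv_continuous gz Pz.
exact: filterI.
Qed.

End Charts.

Section AnalyticLocus.
Variables (R : realType) (m : nat) (M : complex_manifold R m).
Local Notation C := R[i].
Local Notation V := ('rV[C]_m : normedModType C).
Implicit Types (U Q : set M) (phi : chart C m [set: M]).

Lemma near_chart phi x (d : R) (P : set M) : cdom phi x -> 0 < d ->
  (forall z, rnorm (z - cfun phi x) < d -> P (cinv phi z)) -> nbhs x P.
Proof.
move=> px d0 hP.
have h1 : \forall y \near x, cdom phi y.
  by apply: open_nbhs_nbhs; split => //; exact: chart_dom_open.
have h2 : \forall y \near x, rnorm (cfun phi y - cfun phi x) < d.
  exact: ((@cvg_rnormP _ V _ _ _ _ _).1 (chart_continuous px) d d0).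
near=> y; have py : cdom phi y by near: y.
by rewrite -(chartK py); apply: hP; near: y.
Unshelve. all: by end_near. Qed.

Lemma flat_near0 (f : V -> C^o) (p : V) : (\forall x \near p, f x = 0) ->
  forall j h, iter j (fun (g : V -> C^o) x => 'd g x h : C^o) f p = 0.
Proof.
move=> f0 j h.
suff H : \forall x \near p, iter j (fun (g : V -> C^o) x => 'd g x h : C^o) f x = 0.
  exact: nbhs_singleton H.
elim: j => [//|j /near_join]; apply: filterS => x x0.
have [] // : is_diff x (iter j (fun (g : V -> C^o) x => 'd g x h : C^o) f) (\0 : V -> C^o).
  apply: (@rnorm_is_diff _ V C^o _ _ 0) => [v|e e0].
    by rewrite rnorm0 mul0r.
  have /nbhs_rnormP[d d0 hd] := x0; exists d => // v vd.
  have -> : iter j (fun (g : V -> C^o) x => 'd g x h : C^o) f x = 0 by exact: nbhs_singleton x0.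
  rewrite hd; last by rewrite addrAC subrr add0r.
  by rewrite !subr0 rnorm0 mulr_ge0 ?rnorm_ge0// ltW.
by move=> _ /= ->.
Qed.

Variable I : finType.

Definition analytic_locus U Q := forall x, U x -> exists phi,
  [/\ atlas phi, cdom phi x & exists h : I -> V -> C^o,
    (forall k (z : V), ccod phi z -> U (cinv phi z) -> differentiable (h k) z) /\
    (forall z, ccod phi z -> U (cinv phi z) ->
      (Q (cinv phi z) <-> forall k, h k z = 0))].

Lemma analytic_locus_ball U Q x : open U -> analytic_locus U Q -> U x ->
  exists phi, [/\ atlas phi, cdom phi x & exists h : I -> V -> C^o, exists2 S : R, 0 < S &
    exists B : I -> R, [/\
      forall z, rnorm (z - cfun phi x) < S -> ccod phi z /\ U (cinv phi z),
      forall k, holo_ball (h k) (cfun phi x) S,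
      forall k z, rnorm (z - cfun phi x) < S -> rnorm (h k z) <= B k
    & forall z, rnorm (z - cfun phi x) < S ->
      (Q (cinv phi z) <-> forall k, h k z = 0)]].
Proof.
move=> oU QU Ux; have [phi [aphi px [h [hd hQ]]]] := QU x Ux.
exists phi; split=> //; exists h; set p := cfun phi x.
have pc : ccod phi p := chart_cod px.
have [S1 S10 hS1] : exists2 S : R, 0 < S & forall z : V, rnorm (z - p) < S ->
    ccod phi z /\ U (cinv phi z).
  apply/(@nbhs_rnormP _ V); apply: chart_near => //.
  by rewrite chartK//; apply: open_nbhs_nbhs; split.
have hol k : holo_ball (h k) p S1 by move=> z /hS1[]; exact: hd.
have /boolp.choice[SB hSB] : forall k, exists SB : R * R,
    0 < SB.1 <= S1 /\ forall z, rnorm (z - p) < SB.1 -> rnorm (h k z) <= SB.2.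
  by move=> k; have [S' S'0 [B hB]] := locally_bounded S10 (hol k); exists (S', B).
have [S [S0 SS1 hS]] : exists S : R, [/\ 0 < S, S <= S1 & forall k, S <= (SB k).1].
  exists (\big[Num.min/S1]_k (SB k).1); split.
  - by apply: lt_bigmin => // k _; have [/andP[]] := hSB k.
  - exact: bigmin_le_id.
  - by move=> k; exact: bigmin_le_cond.
exists S => //; exists (fun k => (SB k).2); split.
- by move=> z zS; apply: hS1; exact: lt_le_trans SS1.
- by move=> k z zS; apply: hol; exact: lt_le_trans SS1.
- by move=> k z zS; apply: (hSB k).2; exact: lt_le_trans (hS k).
- by move=> z zS; have [c1 c2] := hS1 z (lt_le_trans zS SS1); exact: hQ.
Qed.

Local Notation c0 := (32 * expR 1 : R).

Lemma analytic_locus_closed U Q x : open U -> analytic_locus U Q -> U x ->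
  closure Q^° x -> nbhs x Q.
Proof.
move=> oU QU Ux clx.
have [phi [aphi px [h [S S0 [B [inS hol hB hQ]]]]]] := analytic_locus_ball oU QU Ux.
set p := cfun phi x in inS hol hB hQ.
pose d := Num.min (S / 2) (S / (4 * c0)).
have c0_gt0 : 0 < c0 by rewrite mulr_gt0// expR_gt0.
have d0 : 0 < d by rewrite lt_min !divr_gt0// mulr_gt0.
have xd : nbhs x [set y | cdom phi y /\ rnorm (cfun phi y - p) < d].
  apply: filterI.
    by apply: open_nbhs_nbhs; split => //; exact: chart_dom_open.
  exact: ((@cvg_rnormP _ V _ _ _ _ _).1 (chart_continuous px) d d0).
have [y [yQ [py yd]]] := clx _ xd.
have yd1 : rnorm (cfun phi y - p) < S / 2 by move: yd; rewrite lt_min => /andP[].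
have yd2 : d <= S / (4 * c0) by rewrite ge_min lexx orbT.
have S2 : 0 < S / 2 by rewrite divr_gt0.
have sub : rnorm (cfun phi y - p) + S / 2 <= S.
  by rewrite [leRHS]splitr lerD2r ltW.
have SS : S / 2 < S by rewrite ltr_pdivrMr// ltr_pMr// ltr1n.
apply: (near_chart px d0) => z zd; have zS : rnorm (z - p) < S.
  by rewrite (lt_trans zd)// (le_lt_trans _ SS)// ge_min lexx.
apply/(hQ _ zS) => k.
apply: (@holo_flat_eq0 _ V (h k) (cfun phi y) z (S / 2) (B k) S2).
- exact: holo_ball_sub sub (hol k).
- exact: bounded_ball_sub sub (hB k).
- apply: flat_near0.
  have n1 : \forall w \near cfun phi y, ccod phi w /\ (Q^°) (cinv phi w).
    apply: chart_near; first exact: chart_cod.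
    by rewrite chartK//; apply: open_nbhs_nbhs; split => //; exact: open_interior.
  have n2 : \forall w \near (cfun phi y : V), rnorm (w - p) < S.
    apply/(@nbhs_rnormP _ V); exists (S / 2) => // w wy.
    rewrite -(subrK (cfun phi y) w) -addrA (le_lt_trans (ler_rnormD _ _))//.
    by rewrite (lt_le_trans _ sub)// [ltRHS]addrC ltr_leD.
  apply: filterS2 n1 n2 => w [_ wQ] wS.
  by have /(hQ _ wS) := interior_subset wQ; apply.
have zy : rnorm (z - cfun phi y) <= d + d.
  have -> : z - cfun phi y = (z - p) - (cfun phi y - p) by rewrite opprB addrA subrK.
  by rewrite (le_trans (ler_rnormB _ _))// lerD// ltW.
rewrite -ler_pdivlMr// (le_trans zy)//.
have -> : S / 2 / c0 = S / (4 * c0) + S / (4 * c0) by field; rewrite gt_eqF.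
by rewrite lerD.
Qed.

Lemma analytic_locus_component U Q x y : open U -> analytic_locus U Q ->
  connected_component U x y -> nbhs x Q -> nbhs y Q.
Proof.
move=> oU QU xy xQ.
have Ux : U x by case: xy => A [Ax AU _ _]; exact: AU.
have CU : connected_component U x `<=` U by exact: connected_component_sub.
have CC : connected (connected_component U x) by exact: component_connected.
have E : connected_component U x `&` Q^° = connected_component U x.
  apply: CC.
  - by exists x; split => //; exact: connected_component_refl.
  - by exists Q^° => //; exact: open_interior.
  exists (closure Q^°); first exact: closed_closure.
  apply/seteqP; split=> z [zC zQ]; split=> //; first exact: subset_closure.
  by apply: (analytic_locus_closed oU QU) => //; exact: CU.
by move: xy; rewrite -E => -[].
Qed.

End AnalyticLocus.

Section OnSubmanifold.
Variables (R : realType) (m : nat) (M : complex_manifold R m) (N : set M).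
Local Notation C := R[i].
Local Notation V := ('rV[C]_m : normedModType C).
Local Notation cmx := (map_mx (real_complex R)).

Lemma frame_unit (g : chart R m N) (phi : chart C m [set: M]) t :
  totally_real N -> analytic_chart g -> atlas phi -> ccod g t ->
  cdom phi (cinv g t) -> tangent_frame g phi t \in unitmx.
Proof.
move=> tr ag aphi gt pt; set A := tangent_frame g phi t.
have [_ inj] := ag _ aphi _ gt pt.
have inj0 (a : 'rV[R]_m) : cmx a *m A = 0 -> a = 0.
  by move=> a0; apply: inj; rewrite /= a0 map_mx0 mul0mx.
rewrite -row_free_unit; apply: inj_row_free => v vA.
pose a := map_mx (@complex.Re R) v; pose b := map_mx (@complex.Im R) v.
have vE : v = cmx a + 'i *: cmx b by apply/matrixP => i j; rewrite !mxE -complexE.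
have abA : cmx a *m A = 'i *: (cmx (- b) *m A).
  apply/eqP; rewrite -subr_eq0; apply/eqP; rewrite -[RHS]vA vE mulmxDl -scalemxAl.
  by rewrite map_mxN mulNmx scalerN opprK.
have : (tangent_space g phi t `&` [set 'i *: v | v in tangent_space g phi t]) (cmx a *m A).
  by split; [exists a|exists (cmx (- b) *m A) => //; exists (- b)].
have -> : tangent_space g phi t `&` [set 'i *: v | v in tangent_space g phi t] = [set 0].
  exact: tr.
move=> /= aA0; have a0 := inj0 _ aA0.
have i0 : 'i != 0 :> C by rewrite eq_complex /= oner_eq0 andbF.
move: abA; rewrite aA0 => /esym/eqP; rewrite scaler_eq0 (negPf i0) /= => /eqP/inj0/eqP.
by rewrite oppr_eq0 => /eqP b0; rewrite vE a0 b0 !map_mx0 scaler0 addr0.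
Qed.

Lemma frame_tangent (g : chart R m N) (phi : chart C m [set: M]) t :
  analytic_chart g -> atlas phi -> ccod g t -> cdom phi (cinv g t) ->
  has_tangent (local_embedding g phi) t (tangent_frame g phi t).
Proof.
move=> ag aphi gt pt; have [an _] := ag _ aphi _ gt pt.
by apply: differentiable_has_tangent => k; case: (an k).
Qed.

Lemma chart_sub (g : chart R m N) x : cdom g x -> N x.
Proof. by have [W _ ->] := cdom_open g => -[]. Qed.

Lemma near_chart_dom (g : chart R m N) (phi : chart C m [set: M]) t :
  ccod g t -> cdom phi (cinv g t) ->
  \forall s \near t, ccod g s /\ cdom phi (cinv g s).
Proof.
move=> gt pt; apply: chart_near => //.
by apply: open_nbhs_nbhs; split => //; exact: chart_dom_open.
Qed.

Lemma local_embedding_near (g : chart R m N) (phi : chart C m [set: M]) t (P : set V) :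
  ccod g t -> cdom phi (cinv g t) -> nbhs (local_embedding g phi t : V) P ->
  \forall s \near t, P (local_embedding g phi s).
Proof.
move=> gt pt Pt; exact: (continuous_comp (chart_inv_continuous gt) (chart_continuous pt)) Pt.
Qed.

Lemma analytic_locus_totally_real (I : finType) U Q x : open U -> N `<=` U ->
  analytic_submanifold N -> totally_real N -> analytic_locus I U Q -> N x ->
  (\forall y \near x, N y -> Q y) -> nbhs x Q.
Proof.
move=> oU NU sN tr QU Nx xQ.
have [phi [aphi px [h [S S0 [B [inS hol hB hQ]]]]]] := analytic_locus_ball oU QU (NU _ Nx).
have [g ag gx] := sN _ Nx; pose t := cfun g x; pose F := local_embedding g phi.
have gt : ccod g t := chart_cod gx.
have tx : cinv g t = x := chartK gx.
have Ft : F t = cfun phi x by rewrite /F /local_embedding tx.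
have pt : cdom phi (cinv g t) by rewrite tx.
have n1 := near_chart_dom gt pt.
have n2 : \forall s \near t, rnorm (F s - F t) < S.
  apply: (@local_embedding_near g phi t (fun z => rnorm (z - F t) < S)) => //.
  by apply/(@nbhs_rnormP _ V); exists S.
have n3 : \forall s \near t, ccod g s /\ (N (cinv g s) -> Q (cinv g s)).
  by apply: (@chart_near _ _ _ _ g t (fun y => N y -> Q y)) => //; rewrite tx.
have c0_gt0 : 0 < 32 * expR 1 :> R by rewrite mulr_gt0// expR_gt0.
have S1 : 0 < S / (32 * expR 1) by rewrite divr_gt0.
apply: (near_chart px S1) => z zS.
have zS' : rnorm (z - cfun phi x) < S.
  rewrite (lt_le_trans zS)// ler_pdivrMr// ler_peMr ?(ltW S0)//.
  have := expR_ge1Dx (1 : R); lra.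
apply/(hQ _ zS') => k.
apply: (@holo_flat_eq0 _ V (h k) (cfun phi x) z S (B k) S0 (hol k) (hB k)); last first.
  by rewrite -ler_pdivlMr// ltW.
rewrite -Ft => j w; apply: (@holo_flat_on_frame R m F t (h k) S S0) => //.
- by rewrite Ft.
- apply: filterS n1 => s [gs ps]; exists (tangent_frame g phi s).
    exact: frame_unit.
  exact: frame_tangent.
near=> s; have [gs ps] : ccod g s /\ cdom phi (cinv g s) by near: s.
have FS : rnorm (F s - cfun phi x) < S by rewrite -Ft; near: s.
have Fs : cinv phi (F s) = cinv g s by rewrite /F /local_embedding chartK.
have [_ NQ] : ccod g s /\ (N (cinv g s) -> Q (cinv g s)) by near: s.
have /(hQ _ FS) : Q (cinv phi (F s)).
  by rewrite Fs; apply: NQ; apply: (@chart_sub g); exact: chart_dom.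
by apply.
Unshelve. all: by end_near. Qed.

End OnSubmanifold.

Lemma row_free_minor (F : fieldType) m n (A : 'M[F]_(m, n)) :
  row_free A <-> exists s : {ffun 'I_m -> 'I_n}, \det (colsub s A) != 0.
Proof.
split=> [Af|[s sA]].
  have fT : row_full A^T by rewrite /row_full mxrank_tr.
  exists (fullrankfun fT); have := fullrowsub_unit fT.
  by rewrite unitmxE unitfE -det_tr trmx_mxsub trmxK.
have : row_free (A *m colsub s 1%:M).
  by rewrite mulmx_colsub mulmx1 row_free_unit unitmxE unitfE.
rewrite /row_free => /eqP sm; rewrite eqn_leq rank_leq_row -[X in (X <= _)%N]sm.
exact: mxrankM_maxl.
Qed.

Lemma row_free_mulmx_unit (F : fieldType) m n (A : 'M[F]_(m, n)) (B : 'M[F]_n) :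
  B \in unitmx -> row_free (A *m B) = row_free A.
Proof. by move=> Bu; rewrite /row_free mxrankMfree// row_free_unit. Qed.

Lemma row_free_rows (F : fieldType) m n (a b : 'I_m -> 'rV[F]_n) (B : 'M[F]_n) :
  B \in unitmx -> (forall i, a i = b i *m B) ->
  row_free (\matrix_i a i) = row_free (\matrix_i b i).
Proof.
move=> Bu ab; rewrite -(@row_free_mulmx_unit _ _ _ (\matrix_i b i) _ Bu).
by congr row_free; apply/row_matrixP => i; rewrite row_mul !rowK.
Qed.

Lemma independent_differentials_congr (K : numFieldType) m n
    (f g : 'I_n -> 'rV[K]_m -> K) z w (J : 'M[K]_m) : J \in unitmx ->
  (forall i, grad (f i) z = grad (g i) w *m J) ->
  independent_differentials f z = independent_differentials g w.
Proof. exact: row_free_rows. Qed.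

Section Realification.
Variables (R : realType) (m : nat).
Local Notation cmx := (map_mx (real_complex R)).

Lemma poisson_complex (W : 'M[R]_m) (a b : 'rV[R]_m) :
  poisson (cmx W) (cmx a) (cmx b) = (poisson W a b)%:C.
Proof.
by rewrite /poisson /hamiltonian -map_invmx -!map_mxM map_trmx -map_mxM mxE.
Qed.

Lemma map_complex_Re n p (X : 'M[R[i]]_(n, p)) :
  (forall i j, complex.Im (X i j) = 0) -> cmx (map_mx (@complex.Re R) X) = X.
Proof.
move=> X0; apply/matrixP => i j; rewrite !mxE; move: (X0 i j).
by case: (X i j) => x y /= ->.
Qed.

End Realification.

Section ChartChange.
Variables (R : realType) (m : nat) (M : complex_manifold R m).
Local Notation C := R[i].
Local Notation V := ('rV[C]_m : normedModType C).
Implicit Types (phi psi : chart C m [set: M]) (f : M -> C).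

Lemma grad_chart_change phi psi z f : atlas phi -> atlas psi ->
  ccod phi z -> cdom psi (cinv phi z) ->
  differentiable (f \o cinv psi : V -> C^o) (cfun psi (cinv phi z)) ->
  grad (f \o cinv phi) z =
  grad (f \o cinv psi) (cfun psi (cinv phi z)) *m (jacobian (cfun psi \o cinv phi) z)^T.
Proof.
move=> aphi apsi phiz psiz fd.
rewrite -(grad_comp (atlas_holomorphic aphi apsi phiz psiz) fd).
apply: near_grad; have psin : nbhs (cinv phi z) (cdom psi).
  by apply: open_nbhs_nbhs; split => //; exact: chart_dom_open.
by apply: filterS (chart_near phiz psin) => w [_ pw] /=; rewrite chartK.
Qed.

Definition diff_row (f : V -> C^o) (z : V) : 'rV[C]_m :=
  \row_j 'd f z (delta_mx 0 j).

Lemma grad_diff_row (f : V -> C^o) z : differentiable f z -> grad f z = diff_row f z.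
Proof. by move=> fd; apply/rowP => j; rewrite grad_entry// mxE. Qed.

Lemma diff_row_differentiable (U : set M) phi z f : open U -> ccod phi z -> U (cinv phi z) ->
  (forall w, ccod phi w -> U (cinv phi w) -> differentiable (f \o cinv phi : V -> C^o) w) ->
  mx_differentiable (z : V) (diff_row (f \o cinv phi)).
Proof.
move=> oU pz Uz fd i j; have Un : nbhs (cinv phi z) U by exact: open_nbhs_nbhs.
have /(@nbhs_rnormP _ V)[d d0 hd] := chart_near pz Un.
have -> : (fun x : V => diff_row (f \o cinv phi) x i j : C^o) =
    (fun x => 'd (f \o cinv phi : V -> C^o) x (delta_mx 0 j) : C^o).
  by apply/funext => x; rewrite mxE.
by apply: (@differentiable_diff _ _ _ _ _ d d0) => q /hd[pq Uq]; exact: fd.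
Qed.

Lemma jacobian_unit (Omega : holomorphic_symplectic_form M) phi psi z :
  atlas phi -> atlas psi -> ccod phi z -> cdom psi (cinv phi z) ->
  jacobian (cfun psi \o cinv phi) z \in unitmx.
Proof.
move=> aphi apsi pz qz.
exact: unit_congr (form_compatible Omega aphi apsi pz qz) (form_nondegenerate Omega aphi pz).
Qed.

End ChartChange.

Section RealForm.
Variables (R : realType) (m : nat) (M : complex_manifold R m) (N : set M).
Variable Omega : holomorphic_symplectic_form M.
Local Notation C := R[i].
Local Notation V := ('rV[C]_m : normedModType C).
Local Notation cmx := (map_mx (real_complex R)).
Variables (g : chart R m N) (phi : chart C m [set: M]) (t : 'rV[R]_m).
Hypotheses (ag : analytic_chart g) (aphi : atlas phi).
Hypotheses (gt : ccod g t) (pt : cdom phi (cinv g t)).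

Lemma complex_induced_form : restricts_to_real N Omega ->
  cmx (induced_form Omega g phi t) =
  tangent_frame g phi t *m Omega phi (local_embedding g phi t) *m (tangent_frame g phi t)^T.
Proof.
move=> rr; rewrite /induced_form; set A := tangent_frame g phi t.
apply: map_complex_Re => i j.
have rowA k : tangent_space g phi t (cmx (delta_mx 0 k) *m A) by exists (delta_mx 0 k).
have := rr _ _ ag aphi _ gt pt _ _ (rowA i) (rowA j).
by rewrite trmx_mul !mulmxA !map_delta_mx -rowE trmx_delta -!row_mul -colE !mxE.
Qed.

Lemma real_grad (f : M -> C) (u : M -> R) :
  differentiable (f \o cinv phi : V -> C^o) (local_embedding g phi t : V) ->
  (forall x, N x -> f x = (u x)%:C) ->
  cmx (grad (u \o cinv g) t) =
  grad (f \o cinv phi) (local_embedding g phi t) *m (tangent_frame g phi t)^T.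
Proof.
move=> fd fu; apply/rowP => j.
rewrite !mxE (@tangent_derive R m (local_embedding g phi) t (tangent_frame g phi t)
  (f \o cinv phi) (u \o cinv g)) //.
- rewrite diff_grad// map_delta_mx -rowE !mxE; apply: eq_bigr => k _.
  by rewrite !mxE mulrC.
- exact: frame_tangent.
apply: filterS (near_chart_dom gt pt) => s [gs ps] /=.
by rewrite /local_embedding chartK//; apply: fu; apply: (@chart_sub _ _ _ _ g); exact: chart_dom.
Qed.

End RealForm.

(** * Integrability of the extensions *)

Section ChartwiseLocus.
Variables (R : realType) (m : nat) (M : complex_manifold R m).
Local Notation C := R[i].
Local Notation V := ('rV[C]_m : normedModType C).
Variables (I : finType) (U : set M).
Variables (P : chart C m [set: M] -> 'rV[C]_m -> Prop).
Variable h : chart C m [set: M] -> I -> V -> C^o.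

Hypothesis P_chart : forall phi psi z, atlas phi -> atlas psi -> ccod phi z ->
  cdom psi (cinv phi z) -> U (cinv phi z) -> P psi (cfun psi (cinv phi z)) -> P phi z.
Hypothesis h_diff : forall phi, atlas phi -> forall z, ccod phi z -> U (cinv phi z) ->
  forall k, differentiable (h phi k) (z : V).
Hypothesis hP : forall phi, atlas phi -> forall z, ccod phi z -> U (cinv phi z) ->
  (P phi z <-> forall k, h phi k z = 0).

Definition in_all_charts (x : M) := forall phi, atlas phi -> cdom phi x -> P phi (cfun phi x).

Lemma in_all_chartsE phi z : atlas phi -> ccod phi z -> U (cinv phi z) ->
  (in_all_charts (cinv phi z) <-> P phi z).
Proof.
move=> aphi pz Uz; split=> [/(_ phi aphi (chart_dom pz))|Pz psi apsi qz].
  by rewrite chart_invK.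
have qK := chartK qz; apply: (P_chart apsi aphi).
- exact: chart_cod.
- by rewrite qK; exact: chart_dom.
- by rewrite qK.
by rewrite qK chart_invK.
Qed.

Lemma chartwise_analytic_locus : analytic_locus I U in_all_charts.
Proof.
move=> x Ux; have [phi aphi px] := atlas_cover x; exists phi; split => //.
exists (h phi); split=> [k z pz Uz|z pz Uz]; first exact: h_diff.
by rewrite in_all_chartsE//; exact: hP.
Qed.

End ChartwiseLocus.

Section Commutation.
Variables (R : realType) (n : nat) (M : complex_manifold R (2 * n)).
Variable Omega : holomorphic_symplectic_form M.
Local Notation C := R[i].
Local Notation V := ('rV[C]_(2 * n) : normedModType C).
Variables (U : set M) (v : 'I_n -> M -> C).
Hypotheses (oU : open U) (hv : forall i, holomorphic_on U (v i)).
Implicit Types (phi psi : chart C (2 * n) [set: M]).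

Definition commute_in phi z := forall i j,
  poisson (Omega phi z) (grad (v i \o cinv phi) z) (grad (v j \o cinv phi) z) = 0.

Definition bracket_numerator phi (ij : 'I_n * 'I_n) (z : V) : C^o :=
  (diff_row (v ij.1 \o cinv phi) z *m
    (diff_row (v ij.2 \o cinv phi) z *m \adj (Omega phi z))^T) 0 0.

Lemma commute_locus : analytic_locus ('I_n * 'I_n)%type U (in_all_charts commute_in).
Proof.
apply: (@chartwise_analytic_locus _ _ _ _ _ _ bracket_numerator).
- move=> phi psi z aphi apsi pz qz Uz Pq i j.
  have dpsi k : differentiable (v k \o cinv psi : V -> C^o) (cfun psi (cinv phi z) : V).
    by apply: hv => //; [exact: chart_cod|rewrite chartK].
  rewrite !(@grad_chart_change _ _ _ phi psi)//.
  rewrite (poisson_congr _ _ _ _ (form_compatible Omega aphi apsi pz qz)) ?form_nondegenerate//.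
  exact: chart_cod.
- move=> phi aphi z pz Uz k.
  have dr i : mx_differentiable (z : V) (diff_row (v i \o cinv phi)).
    by apply: (diff_row_differentiable oU) => // w pw Uw; exact: hv.
  apply: (mx_differentiable_mul (dr k.1)); apply: mx_differentiable_tr.
  apply: (mx_differentiable_mul (dr k.2)); apply: mx_differentiable_adj.
  by move=> i j; exact: form_holomorphic.
move=> phi aphi z pz Uz.
have dv i : grad (v i \o cinv phi) z = diff_row (v i \o cinv phi) z.
  by apply: grad_diff_row; exact: hv.
split=> [Pz [i j]|Pz i j].
  by apply/eqP; rewrite -poisson_adj ?form_nondegenerate// -!dv; apply/eqP.
by apply/eqP; rewrite poisson_adj ?form_nondegenerate// !dv; apply/eqP/(Pz (i, j)).
Qed.

Lemma commute_on_real_form (N : set M) (u : 'I_n -> M -> R) x :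
  analytic_real_symplectic_form N Omega -> real_integrable_system Omega N u ->
  N `<=` U -> (forall i x, N x -> v i x = (u i x)%:C) ->
  N x -> in_all_charts commute_in x.
Proof.
move=> [sN tr rr] [com _] NU vu Nx phi aphi px i j.
have [g ag gx] := sN _ Nx; have gt := chart_cod gx; have tx := chartK gx.
have pt : cdom phi (cinv g (cfun g x)) by rewrite tx.
have Ft : local_embedding g phi (cfun g x) = cfun phi x by rewrite /local_embedding tx.
have dv k : differentiable (v k \o cinv phi : V -> C^o) (local_embedding g phi (cfun g x) : V).
  rewrite Ft; apply: hv => //; first exact: chart_cod.
  by rewrite chartK//; exact: NU.
have := congr1 (real_complex R) (com g phi ag aphi _ gt pt i j).
rewrite -poisson_complex !(real_grad ag aphi gt pt (dv _) (vu _)) -Ft.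
have Au := frame_unit tr ag aphi gt pt.
have Fc : ccod phi (local_embedding g phi (cfun g x)) by rewrite Ft; exact: chart_cod.
have WE := complex_induced_form ag aphi gt pt rr.
have Wu : map_mx (real_complex R) (induced_form Omega g phi (cfun g x)) \in unitmx.
  by rewrite WE !unitmx_mul unitmx_tr Au form_nondegenerate.
move=> /eqP; rewrite rmorph0 => /eqP P0.
have E := poisson_congr (grad (v i \o cinv phi) (local_embedding g phi (cfun g x)))
  (grad (v j \o cinv phi) (local_embedding g phi (cfun g x)))
  Wu (form_nondegenerate Omega aphi Fc) WE.
by rewrite E in P0.
Qed.

End Commutation.

Section Independence.
Variables (R : realType) (n : nat) (M : complex_manifold R (2 * n)).
Variable Omega : holomorphic_symplectic_form M.
Local Notation C := R[i].
Local Notation V := ('rV[C]_(2 * n) : normedModType C).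
Local Notation cmx := (map_mx (real_complex R)).
Variables (U : set M) (v : 'I_n -> M -> C).
Hypotheses (oU : open U) (hv : forall i, holomorphic_on U (v i)).
Implicit Types (phi psi : chart C (2 * n) [set: M]).

Definition dependent_in phi z :=
  ~ independent_differentials (fun i => v i \o cinv phi) z.

Definition differential_minor phi (s : {ffun 'I_n -> 'I_(2 * n)}) (z : V) : C^o :=
  \det (colsub s (\matrix_i diff_row (v i \o cinv phi) z)).

Lemma dependent_in_chart phi psi z : atlas phi -> atlas psi -> ccod phi z ->
  cdom psi (cinv phi z) -> U (cinv phi z) ->
  dependent_in psi (cfun psi (cinv phi z)) -> dependent_in phi z.
Proof.
move=> aphi apsi pz qz Uz; apply: contra_not.
have dpsi k : differentiable (v k \o cinv psi : V -> C^o) (cfun psi (cinv phi z) : V).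
  by apply: hv => //; [exact: chart_cod|rewrite chartK].
have Ju : (jacobian (cfun psi \o cinv phi) z)^T \in unitmx.
  by rewrite unitmx_tr (jacobian_unit Omega).
have gE i := grad_chart_change aphi apsi pz qz (dpsi i).
by move=> ind; rewrite -(independent_differentials_congr Ju gE).
Qed.

Lemma differential_minor_differentiable phi : atlas phi ->
  forall z, ccod phi z -> U (cinv phi z) ->
  forall s, differentiable (differential_minor phi s) (z : V).
Proof.
move=> aphi z pz Uz s; apply: differentiable_det => i j.
have -> : (fun x : V => colsub s (\matrix_i diff_row (v i \o cinv phi) x) i j : C^o) =
    (fun x => diff_row (v i \o cinv phi) x 0 (s j) : C^o).
  by apply/funext => x; rewrite !mxE.
by apply: (diff_row_differentiable oU) => // w pw Uw; exact: hv.
Qed.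

Lemma dependent_minor phi : atlas phi -> forall z, ccod phi z -> U (cinv phi z) ->
  (dependent_in phi z <-> forall s, differential_minor phi s z = 0).
Proof.
move=> aphi z pz Uz; rewrite /dependent_in /independent_differentials.
have -> : \matrix_i grad (v i \o cinv phi) z = \matrix_i diff_row (v i \o cinv phi) z.
  by apply/row_matrixP => i; rewrite !rowK; apply: grad_diff_row; exact: hv.
rewrite row_free_minor; split=> [ns s|s0 [s]]; last by rewrite [X in X != 0]s0 eqxx.
by apply/eqP; apply: contra_notT ns => s0; exists s.
Qed.

Definition dependent_set := in_all_charts dependent_in.

Lemma dependent_locus : analytic_locus {ffun 'I_n -> 'I_(2 * n)} U dependent_set.
Proof.
apply: (@chartwise_analytic_locus _ _ _ _ _ _ differential_minor).
- exact: dependent_in_chart.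
- exact: differential_minor_differentiable.
- exact: dependent_minor.
Qed.

Lemma independent_open : open (U `&` ~` dependent_set).
Proof.
rewrite openE => x [Ux nx]; have [phi aphi px] := atlas_cover x.
have pz : ccod phi (cfun phi x) by exact: chart_cod.
have Uz : U (cinv phi (cfun phi x)) by rewrite chartK.
have : ~ dependent_in phi (cfun phi x).
  by move/(in_all_chartsE dependent_in_chart aphi pz Uz); rewrite chartK.
rewrite dependent_minor// => /existsNP[s /eqP s0].
have sn : \forall z \near (cfun phi x : V), differential_minor phi s z != 0.
  exact: (@cvgr_neq0 C C^o _ _ _ _ _ (differentiable_continuous
    (differential_minor_differentiable aphi pz Uz s)) s0).
have sx : \forall y \near x, differential_minor phi s (cfun phi y) != 0.
  exact: (chart_continuous px) sn.
have xU : \forall y \near x, U y by exact: open_nbhs_nbhs.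
have xp : \forall y \near x, cdom phi y.
  by apply: open_nbhs_nbhs; split => //; exact: chart_dom_open.
near=> y; have Uy : U y by near: y.
have py : cdom phi y by near: y.
have sy : differential_minor phi s (cfun phi y) != 0 by near: y.
split=> // /(_ phi aphi py); rewrite dependent_minor ?chartK//; last exact: chart_cod.
by move/(_ s)/eqP; apply/negP.
Unshelve. all: by end_near. Qed.

Lemma independent_on_real_form (N : set M) (u : 'I_n -> M -> R) x (g : chart R (2 * n) N) :
  totally_real N -> N `<=` U -> (forall i x, N x -> v i x = (u i x)%:C) ->
  analytic_chart g -> cdom g x ->
  independent_differentials (fun i => u i \o cinv g) (cfun g x) -> ~ dependent_set x.
Proof.
move=> tr NU vu ag gx ind dx; have [phi aphi px] := atlas_cover x.
have Nx := chart_sub gx; have gt := chart_cod gx; have tx := chartK gx.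
have pt : cdom phi (cinv g (cfun g x)) by rewrite tx.
have Ft : local_embedding g phi (cfun g x) = cfun phi x by rewrite /local_embedding tx.
have dv k : differentiable (v k \o cinv phi : V -> C^o) (local_embedding g phi (cfun g x) : V).
  rewrite Ft; apply: hv => //; first exact: chart_cod.
  by rewrite chartK//; exact: NU.
apply: (dx phi aphi px); move: ind.
rewrite /independent_differentials -(row_free_map (real_complex R)).
have -> : cmx (\matrix_(i < n) grad (u i \o cinv g) (cfun g x)) =
    \matrix_(i < n) cmx (grad (u i \o cinv g) (cfun g x)).
  by apply/matrixP => i j; rewrite !mxE.
rewrite (@row_free_rows _ _ _ _ (fun i => grad (v i \o cinv phi) (cfun phi x))
  (tangent_frame g phi (cfun g x))^T) //.
  by rewrite unitmx_tr; exact: frame_unit.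
by move=> i; rewrite -Ft; exact: (real_grad ag aphi gt pt (dv i) (vu i)).
Qed.

End Independence.

Theorem proposition5p3 (R : realType) (n : nat)
    (M : complex_manifold R (2 * n)) (Omega : holomorphic_symplectic_form M)
    (N : set M) (u : 'I_n -> M -> R) :
  analytic_real_symplectic_form N Omega ->
  (forall i, analytic_on_submanifold N (u i)) ->
  real_integrable_system Omega N u ->
  forall (U : set M) (v : 'I_n -> M -> R[i]),
    holomorphic_extensions N u U v ->
    holomorphic_integrable_system Omega U v.
Proof.
move=> rsf _ ris U v [oU NU cU hv vu]; have [sN tr _] := rsf.
have cQ := commute_locus Omega oU hv; have dQ := dependent_locus Omega oU hv.
split=> //.
- move=> phi aphi z pz Uz.
  have [y [zy Ny]] := cU _ Uz.
  have yQ : nbhs y (in_all_charts (commute_in Omega v)).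
    apply: (analytic_locus_totally_real oU NU sN tr cQ Ny).
    by apply: filterE => w Nw; exact: (commute_on_real_form hv rsf ris NU vu).
  have := nbhs_singleton (analytic_locus_component oU cQ (connected_component_sym zy) yQ).
  move=> /(_ phi aphi (chart_dom pz)); rewrite chart_invK//; exact.
- exists (U `&` ~` dependent_set v); last first.
    move=> phi aphi z pz [Uz nz]; apply: contrapT => dz; apply: nz.
    exact: ((in_all_chartsE (dependent_in_chart Omega hv) aphi pz Uz).2 dz).
  split.
    exists (U `&` ~` dependent_set v); first exact: (independent_open Omega).
    by rewrite setIA setIid.
  move=> x Ux B xB; apply: contrapT => nD.
  have xQ : nbhs x (dependent_set v).
    have xU : nbhs x U by exact: open_nbhs_nbhs.
    apply: filterS (filterI xB xU) => y [By Uy]; apply: contrapT => ny.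
    by apply: nD; exists y.
  have [y [xy Ny]] := cU _ Ux.
  have yQ := analytic_locus_component oU dQ xy xQ.
  have [D [[W oW DE] ND] ind] := ris_independent ris.
  have [d [Dd Qd]] := ND _ Ny _ yQ.
  have Nd : N d by move: Dd; rewrite DE => -[].
  have [g ag gd] := sN _ Nd.
  apply: (independent_on_real_form hv tr NU vu ag gd) Qd.
  by apply: ind => //; [exact: chart_cod|rewrite chartK].
Qed.
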